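(* Let $E$ be a Dedekind-complete locally convex-solid Riesz space with the Lebesgue property, let $X$ be a Banach space, and let $T:E\rightarrow X$ be a continuous operator. Then $T$ is generalized $b$-weakly compact if and only if there exist a KR-space $(H,\tau)$, a continuous lattice homomorphism $R:E\rightarrow H$, and an operator $S:H\rightarrow X$ that is continuous from $(H,\tau)$ into $(X,\sigma(X,X^{\prime}))$, such that $T=SR$.
   Context: Conventions: locally convex spaces are real and Hausdorff, Riesz spaces are archimedean, and an operator is a linear map. A locally convex-solid Riesz space is a Riesz space with a locally convex topology generated by Riesz seminorms. It has the Lebesgue property if every net $x_\alpha\downarrow 0$ converges to $0$ topologically. $E^{\prime}$ is the topological dual of $E$ with the strong topology $\beta(E^{\prime},E)$, and $E^{\prime\prime}$ is the strong bidual (the topological dual of $(E^{\prime},\beta(E^{\prime},E))$); both are Riesz spaces for the usual dual orderings, and $E$ is regarded as a Riesz subspace of $E^{\prime\prime}$ via the canonical embedding. A subset $A\subset E$ is topologically $b$-order bounded if it is order bounded as a subset of $E^{\prime\prime}$. An operator $T:E\to X$ into a Banach space is generalized $b$-weakly compact if it maps topologically $b$-order bounded subsets of $E$ to relatively weakly compact subsets of $X$. A KR-space is a locally convex-solid Riesz space $H$ in which every increasing and topologically bounded net $(x_\alpha)\subset H^{+}$ is convergent. $\sigma(X,X^{\prime})$ is the weak topology of $X$. *)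

(* Defs.v *)
From HB Require Import structures.
From mathcomp Require Import all_boot all_order all_algebra.
From mathcomp Require Import all_classical all_reals all_analysis.

Set Implicit Arguments.
Unset Strict Implicit.
Unset Printing Implicit Defensive.

Import Order.TTheory GRing.Theory Num.Theory.
Import numFieldNormedType.Exports.
Local Open Scope classical_set_scope.
Local Open Scope ring_scope.

(* MathComp has no join of [latticeType] with [zmodType], so the lattice
   operations are carried by this mixin. *)
HB.mixin Record POrderedLmodule_isRieszSpace (R : realType) V
    & Num.POrderedZmodule V & GRing.Lmodule R V := {
  riesz_join : V -> V -> V ;
  riesz_meet : V -> V -> V ;
  riesz_leUx : forall x y z : V,
    (riesz_join x y <= z) = (x <= z) && (y <= z) ;
  riesz_lexI : forall x y z : V,
    (z <= riesz_meet x y) = (z <= x) && (z <= y) ;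
  riesz_lerD2l : forall z x y : V, x <= y -> z + x <= z + y ;
  riesz_scaler_ge0 : forall (a : R) (x : V), 0 <= a -> 0 <= x -> 0 <= a *: x ;
  riesz_archimedean : forall x y : V,
    0 <= x -> (forall n : nat, x *+ n <= y) -> x = 0
}.

(* Riesz spaces are archimedean by convention. *)
#[short(type="rieszType")]
HB.structure Definition RieszSpace (R : realType) :=
  {V of POrderedLmodule_isRieszSpace R V & Num.POrderedZmodule V
      & GRing.Lmodule R V}.

Definition riesz_abs (R : realType) (V : rieszType R) (x : V) : V :=
  riesz_join x (- x).

Definition riesz_seminorm (R : realType) (V : rieszType R) (p : V -> R) : Prop :=
  [/\ forall x y, p (x + y) <= p x + p y,
      forall (a : R) x, p (a *: x) = `|a| * p x &
      forall x y, riesz_abs x <= riesz_abs y -> p x <= p y].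

Definition generated_by_seminorms (R : realType) (E : tvsType R)
    (P : set (E -> R)) : Prop :=
  forall (x : E) (U : set E), nbhs x U <->
    exists F : set (E -> R), exists e : R,
      [/\ finite_set F, F `<=` P, 0 < e &
          [set y | forall p, F p -> p (y - x) < e] `<=` U].

HB.mixin Record Tvs_isLocallyConvexSolid (R : realType) E
    & Tvs R E & RieszSpace R E := {
  lcs_riesz_hausdorff : hausdorff_space E ;
  lcs_riesz_seminorms : exists P : set (E -> R),
    (forall p, P p -> riesz_seminorm p) /\ generated_by_seminorms P
}.

#[short(type="lcsRieszType")]
HB.structure Definition LCSRiesz (R : realType) :=
  {E of Tvs_isLocallyConvexSolid R E & Tvs R E & RieszSpace R E}.

Definition directed (I : Type) (leI : I -> I -> Prop) : Prop :=
  [/\ inhabited I, forall i, leI i i,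
      forall i j k, leI i j -> leI j k -> leI i k &
      forall i j, exists k, leI i k /\ leI j k].

Definition net_tails (I : Type) (leI : I -> I -> Prop) : set_system I :=
  filter_from [set: I] (fun i => [set j | leI i j]).

Definition tvs_bounded (R : realType) (E : preTopologicalLmodType R)
    (A : set E) : Prop :=
  forall U : set E, nbhs 0 U -> \forall r \near +oo_R, A `<=` ( *:%R r) @` U.

Definition dedekind_complete (R : realType) (E : rieszType R) : Prop :=
  forall A : set E, has_sup A -> supremums A !=set0.

Definition lebesgue_property (R : realType) (E : lcsRieszType R) : Prop :=
  forall (I : Type) (leI : I -> I -> Prop) (x : I -> E), directed leI ->
    (forall i j, leI i j -> x j <= x i) -> infimums (range x) 0 ->
    x @ net_tails leI --> (0 : E).

Definition KR_space (R : realType) (H : lcsRieszType R) : Prop :=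
  forall (I : Type) (leI : I -> I -> Prop) (x : I -> H), directed leI ->
    (forall i, 0 <= x i) -> (forall i j, leI i j -> x i <= x j) ->
    tvs_bounded (range x) ->
    exists l : H, x @ net_tails leI --> l.

Definition lattice_homomorphism (R : realType) (E H : rieszType R)
    (f : {linear E -> H}) : Prop :=
  forall x y, f (riesz_join x y) = riesz_join (f x) (f y) /\
              f (riesz_meet x y) = riesz_meet (f x) (f y).

Section dual.
Variables (R : realType) (E : preTopologicalLmodType R).

Definition dual_functionals : set (E -> R^o) :=
  [set f | linear f /\ continuous f].

Definition dual_pred : {pred E -> R^o} := fun f => f \in dual_functionals.

Lemma dual_submod_closed : submod_closed dual_pred.
Proof.
split.
  rewrite unfold_in inE; split => [a x y|].
    by rewrite scaler0 add0r.
  exact: cst_continuous.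
move=> a f g; rewrite !unfold_in !inE => -[lf cf] [lg cg]; split.
  move=> b x y; rewrite /= !fctE lf lg !scalerDr !scalerA.
  by rewrite (mulrC a b) addrACA.
by move=> x; apply: cvgD; [apply: cvgZr; exact: cf | exact: cg].
Qed.

HB.instance Definition _ :=
  GRing.isSubmodClosed.Build R (E -> R^o) dual_pred dual_submod_closed.

Definition dual : Type := {f : E -> R^o | f \in dual_pred}.

HB.instance Definition _ := SubChoice.on dual.
HB.instance Definition _ := [SubChoice_isSubLmodule of dual by <:].

Definition dual_fun (f : dual) : E -> R^o := val f.
Coercion dual_fun : dual >-> Funclass.

(* The strong topology: uniform convergence on the bounded subsets of [E]. *)
HB.instance Definition _ := Topological.copy dual
  (initial_topology
     (fun f : dual => (f : {family tvs_bounded (E := E), E -> R^o}))).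

End dual.

(* The strong bidual: [dual E] carries the strong topology. *)
Notation bidual E := (dual (dual E)).

Section order_dual.
Variables (R : realType) (E : lcsRieszType R).

Definition dual_ge0 (f : dual E) : Prop := forall x : E, 0 <= x -> 0 <= f x.

Definition bidual_le (phi psi : bidual E) : Prop :=
  forall f : dual E, dual_ge0 f -> phi f <= psi f.

Lemma tvs_bounded1 (x : E) : tvs_bounded [set x].
Proof.
move=> U U0.
have c : (fun r : R^o => r *: x) @ (0 : R^o) --> 0 *: x.
  apply: (@continuous_comp R^o (R^o * E)%type E (fun r => (r, x))
    (fun z => z.1 *: z.2)); last exact: scale_continuous.
  by apply: (@cvg_pair _ _ _ _ (nbhs (0 : R^o))); [exact: cvg_id|exact: cvg_cst].
have /c : nbhs (0 *: x) U by rewrite scale0r.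
move=> /nbhs_ballP[e /= e0 eU].
near=> r.
have r0 : 0 < r by near: r; exact: nbhs_pinfty_gt.
move=> _ ->; exists (r^-1 *: x); last by rewrite scalerA divff ?gt_eqF// scale1r.
apply: eU; rewrite /ball /= sub0r normrN gtr0_norm ?invr_gt0//.
rewrite invf_plt ?posrE//.
by near: r; apply: nbhs_pinfty_gt; exact: num_real.
Unshelve. all: by end_near. Qed.

Lemma evaluation_dual (x : E) :
  (fun f : dual E => f x : R^o) \in @dual_pred R (dual E).
Proof.
rewrite unfold_in inE; split; first by [].
move=> f; rewrite /continuous_at.
apply/(@cvg_entourageP R^o ((fun g : dual E => g x : R^o) @ nbhs f)) => V entV.
pose incl (g : dual E) : {family tvs_bounded (E := E), E -> R^o} := dual_fun g.
have nf := @fam_nbhs E R^o (tvs_bounded (E := E)) [set x] V (incl f) entV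
  (tvs_bounded1 x).
have icont : incl @ nbhs (f : dual E) --> incl f.
  exact: (@initial_continuous (dual E) _ incl f).
have : nbhs (f : dual E) [set g : dual E | V (dual_fun f x, g x)].
  have := icont _ nf; rewrite /= nbhs_simpl.
  by apply: (@filterS _ (nbhs (f : dual E))) => g /= /(_ x erefl).
by [].
Qed.

Definition bidual_embed (x : E) : bidual E :=
  exist (fun phi => phi \in @dual_pred R (dual E)) _ (evaluation_dual x).

Definition b_order_bounded (A : set E) : Prop :=
  exists u v : bidual E, forall x, A x ->
    bidual_le u (bidual_embed x) /\ bidual_le (bidual_embed x) v.

End order_dual.

(* [X] with the topology sigma(X, X'). *)
Definition weak_space (R : realType) (X : preTopologicalLmodType R) : Type :=
  initial_topology
    (fun x : X => (fun f : dual X => f x) : {ptws dual X -> R^o}).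

HB.instance Definition _ (R : realType) (X : preTopologicalLmodType R) :=
  Topological.on (weak_space X).

Definition generalized_b_weakly_compact (R : realType) (E : lcsRieszType R)
    (X : completeNormedModType R) (T : {linear E -> X}) : Prop :=
  forall A : set E, b_order_bounded A ->
    precompact (T @` A : set (weak_space X)).

(* Main.v *)
(**
Let C be the positive cone of the dual E'. A positive element of the bidual is
called approximable if on each f in C it is the supremum of f over the elements
x >= 0 of E below it. The differences of approximable elements form a Riesz
space H containing E; as E is Dedekind complete with the Lebesgue property, the
positive elements of H are exactly the approximable ones, and H is a KR-space
for the seminorms phi |-> |phi|(f) with f in C: by a gliding hump, a positive
set on which every f in C is bounded is topologically bounded, so that the
pointwise supremum of an increasing bounded net belongs to the bidual.
If T is generalized b-weakly compact and phi in H is approximable, the image of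
{x : 0 <= x <= phi} is relatively weakly compact, which forces the bitranspose
of T to map phi into X; this gives the extension of T to H.

Conversely, let T = S Q factor through a KR-space H. If v in the bidual of E
dominates A, then {x : x <= v} is upward directed and its sections
{x : a <= x <= v} are bounded, so Q maps it below the limit of an increasing
convergent net, and Q A lies in an order interval of H. It remains to see that
an order interval [0, z] of H is weakly compact. For f in C the function
x |-> f(x ^ 2 / z), where x ^ 2 / z = sup_t (2 t x - t ^ 2 z), is uniformly
convex for f(|.|); hence its near-minimizers on the convex sets of an ultrafilter
on [0, z] converge for f(|.|) to some x_f, which represents the weak limit on all
the functionals between 0 and f. Taking x_f minimal, the supremum of the x_f is
the weak limit.
*)
Require Import Defs.
From HB Require Import structures.
From mathcomp Require Import all_boot all_order all_algebra.
From mathcomp Require Import all_classical all_reals all_analysis.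
From mathcomp Require Import lra.

Set Implicit Arguments.
Unset Strict Implicit.
Unset Printing Implicit Defensive.

Import Order.TTheory GRing.Theory Num.Theory.
Import numFieldNormedType.Exports.

Local Open Scope classical_set_scope.
Local Open Scope ring_scope.

Local Notation "x \v y" := (riesz_join x y) (at level 50, left associativity).
Local Notation "x \^ y" := (riesz_meet x y) (at level 50, left associativity).

(** * Hahn-Banach *)

Section hahn_banach.
Variables (R : realType) (V : lmodType R).

Definition sublinear (q : V -> R) : Prop :=
  (forall x y, q (x + y) <= q x + q y) /\
  (forall (a : R) x, 0 <= a -> q (a *: x) = a * q x).

Lemma sublinear0 q : sublinear q -> q 0 = 0.
Proof. by case=> _ /(_ 0 0 (lexx 0)); rewrite scale0r mul0r. Qed.

Lemma sublinearN q x : sublinear q -> - q (- x) <= q x.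
Proof.
move=> sq; rewrite lerNl -subr_ge0 opprK.
by rewrite -(sublinear0 sq) -{1}(addNr x) (le_trans (sq.1 _ _)).
Qed.

Lemma sublinearP q : (forall x y, q (x + y) <= q x + q y) ->
  (forall (a : R) x, 0 < a -> q (a *: x) <= a * q x) -> q 0 = 0 ->
  sublinear q.
Proof.
move=> qD qZ q0; split=> // a x; rewrite le_eqVlt => /predU1P[<-|a0].
  by rewrite scale0r mul0r.
apply/eqP; rewrite eq_le qZ//=.
have := qZ a^-1 (a *: x); rewrite invr_gt0 scalerA mulVf ?gt_eqF// scale1r.
by move=> /(_ a0); rewrite -ler_pdivlMl// mulrC.
Qed.

Lemma linear_fun0 (h : V -> R^o) : linear h -> h 0 = 0.
Proof.
by move=> lh; have := lh (-1) 0 0; rewrite scaler0 addr0 scaleN1r addNr.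
Qed.

Lemma linear_funN (h : V -> R^o) x : linear h -> h (- x) = - h x.
Proof.
move=> lh; have := lh (-1) x 0.
by rewrite !addr0 linear_fun0// addr0 !scaleN1r.
Qed.

Lemma linear_bound_abs (h : V -> R^o) (q : V -> R) : linear h ->
  (forall x, q (- x) = q x) -> (forall x, h x <= q x) ->
  forall x, `|h x| <= q x.
Proof.
move=> lh qN hq x; rewrite ler_norml hq andbT lerNl -qN.
by rewrite -linear_funN.
Qed.

(** A pair [(v, r)] of [K] stands for the constraint [r <= g v] on the linear functional [g] to be
    found. *)
Definition pair_cone (K : set (V * R)) : Prop :=
  [/\ K (0, 0), forall k l, K k -> K l -> K (k + l) &
      forall (a : R) k, 0 < a -> K k -> K (a *: k.1, a * k.2)].

(** A linear [g <= q] meets all the constraints of [K] exactly when it lies below this function, so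
    the constraints are absorbed into a sublinear bound. *)
Definition cone_inf (q : V -> R) (K : set (V * R)) (x : V) : R :=
  inf [set q (x + k.1) - k.2 | k in K].

Section cone_inf.
Variables (q : V -> R) (K : set (V * R)).
Hypotheses (sq : sublinear q) (cK : pair_cone K)
  (Kq : forall k, K k -> k.2 <= q k.1).

Let lb x k : K k -> - q (- x) <= q (x + k.1) - k.2.
Proof.
move=> Kk; have := sq.1 (- x) (x + k.1); rewrite addKr.
by have := Kq Kk; lra.
Qed.

Let has_lb x : has_lbound [set q (x + k.1) - k.2 | k in K].
Proof. by exists (- q (- x)) => _ [k Kk <-]; exact: lb. Qed.

Let ne x : [set q (x + k.1) - k.2 | k in K] !=set0.
Proof. by have [K0 _ _] := cK; exists (q (x + 0) - 0), (0, 0). Qed.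

Lemma cone_inf_le x k : K k -> cone_inf q K x <= q (x + k.1) - k.2.
Proof. by move=> Kk; apply: ge_inf => //; exists k. Qed.

Lemma cone_inf_leq x : cone_inf q K x <= q x.
Proof.
have [K0 _ _] := cK.
by have := cone_inf_le x K0; rewrite /= addr0 subr0.
Qed.

Lemma cone_infN k : K k -> cone_inf q K (- k.1) <= - k.2.
Proof.
move=> /(cone_inf_le (- k.1)); rewrite addNr (sublinear0 sq) sub0r.
by [].
Qed.

Lemma cone_inf_sublinear : sublinear (cone_inf q K).
Proof.
have [K0 KD KZ] := cK; apply: sublinearP => [x y|a x a0|].
- rewrite -lerBlDr; apply: lb_le_inf => // _ [k Kk <-].
  rewrite lerBlDr -lerBlDl; apply: lb_le_inf => // _ [l Kl <-].
  rewrite lerBlDl (le_trans (cone_inf_le _ (KD _ _ Kk Kl)))//=.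
  by have := sq.1 (x + k.1) (y + l.1); rewrite addrACA; lra.
- rewrite -ler_pdivrMl//; apply: lb_le_inf => // _ [k Kk <-].
  rewrite ler_pdivrMl// (le_trans (cone_inf_le _ (KZ _ _ a0 Kk)))//=.
  by rewrite -scalerDr (sq.2 _ _ (ltW a0)) mulrBr.
- apply/eqP; rewrite eq_le; apply/andP; split.
    by rewrite -[leRHS](sublinear0 sq); exact: cone_inf_leq.
  by apply: lb_le_inf => // _ [k Kk <-]; rewrite add0r subr_ge0; exact: Kq.
Qed.

End cone_inf.

(** As a constraint cone, the ray forces [g a = q a] for every linear [g <= q]. *)
Definition ray (q : V -> R) (a : V) : set (V * R) :=
  [set k | exists2 t, 0 <= t & k = (t *: a, t * q a)].

Lemma ray_cone q a : pair_cone (ray q a).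
Proof.
split; first by exists 0 => //; rewrite scale0r mul0r.
- move=> _ _ [s s0 ->] [t t0 ->]; exists (s + t); first exact: addr_ge0.
  by rewrite scalerDl mulrDl.
- move=> b _ b0 [t t0 ->]; exists (b * t); first by rewrite mulr_ge0// ltW.
  by rewrite /= scalerA mulrA.
Qed.

Lemma ray_le q a k : sublinear q -> ray q a k -> k.2 <= q k.1.
Proof. by move=> sq [t t0 ->]; rewrite /= sq.2. Qed.

Lemma ray1 q a : ray q a (a, q a).
Proof. by exists 1; rewrite ?ler01// scale1r mul1r. Qed.

(* Replacing [q] by [x |-> inf_(t >= 0) (q (x + t a) - t q a)] does not decrease
   it, by minimality; at [- a] this gives [q (- a) = - q a]. *)
Lemma minimal_sublinear_linear q : sublinear q ->
  (forall q', sublinear q' -> (forall x, q' x <= q x) ->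
    forall x, q x <= q' x) ->
  linear (q : V -> R^o).
Proof.
move=> sq qmin.
have qN a : q (- a) = - q a.
  have cK := ray_cone q a; have Kq k := @ray_le q a k sq.
  have := qmin _ (cone_inf_sublinear sq cK Kq) (cone_inf_leq sq cK Kq) (- a).
  move=> /le_trans/(_ (cone_infN sq Kq (ray1 q a))) /= h.
  by apply/eqP; rewrite eq_le h /= lerNl; exact: sublinearN.
have qD x y : q (x + y) = q x + q y.
  apply/eqP; rewrite eq_le sq.1/=.
  by have := sq.1 (- x) (- y); rewrite -opprD !qN; lra.
move=> a x y; rewrite qD; congr (_ + _).
have [a0|a0] := leP 0 a; first exact: sq.2.
by rewrite -[LHS]opprK -qN -scaleNr sq.2 ?oppr_ge0 ?ltW// mulNr opprK.
Qed.

Lemma exists_minimal_sublinear q : sublinear q ->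
  exists g, [/\ sublinear g, forall x, g x <= q x &
    forall q', sublinear q' -> (forall x, q' x <= g x) ->
      forall x, g x <= q' x].
Proof.
move=> sq.
pose T := {p : V -> R | sublinear p /\ forall x, p x <= q x}.
pose t0 : T := exist _ q (conj sq (fun x => lexx _)).
(* The order is reversed, so that a maximal element given by Zorn's lemma is a minimal sublinear
   functional. *)
pose le (s t : T) := `[< forall x, sval t x <= sval s x >].
have [||A totA|[g [sg gq]] gmax] := @ZL_preorder T t0 le.
- by move=> t; apply/asboolP.
- move=> t s u /asboolP st /asboolP tu; apply/asboolP => x.
  exact: le_trans (tu x) (st x).
- have [[a Aa]|A0] := pselect (exists a, A a); last first.
    by exists t0 => s As; case: A0; exists s.
  pose S x := [set sval s x | s in A].
  (* A sublinear [p <= q] satisfies [- q (- x) <= - p (- x) <= p x], hence the pointwise infimum of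
     the chain is finite. *)
  have lbS x : has_lbound (S x).
    exists (- q (- x)) => _ [[p [sp pq]] _ <-] /=.
    by rewrite (le_trans _ (sublinearN _ sp))// lerN2.
  have neS x : S x !=set0 by exists (sval a x), a.
  have iS s x : A s -> inf (S x) <= sval s x.
    by move=> As; apply: ge_inf => //; exists s.
  have sS : sublinear (fun x => inf (S x)).
    apply: sublinearP => [x y|b x b0|].
    + rewrite -lerBlDr; apply: lb_le_inf => // _ [s As <-].
      rewrite lerBlDr -lerBlDl; apply: lb_le_inf => // _ [t At <-].
      rewrite lerBlDl; have [ss _] := svalP s; have [st _] := svalP t.
      (* In a chain the smaller of the two members can be used at both points. *)
      have [/asboolP/(_ x) le_x|/asboolP/(_ y) le_y] := totA _ _ As At.
        by rewrite (le_trans (iS _ _ At))// (le_trans (st.1 _ _))// lerD2r.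
      by rewrite (le_trans (iS _ _ As))// (le_trans (ss.1 _ _))// lerD2l.
    + rewrite -ler_pdivrMl//; apply: lb_le_inf => // _ [s As <-].
      rewrite ler_pdivrMl//; have [ss _] := svalP s.
      by rewrite -(ss.2 _ _ (ltW b0)) iS.
    + rewrite (_ : S 0 = [set 0]) ?inf1//; apply/seteqP; split => [y|y ->].
        by move=> [s As <-]; have [ss _] := svalP s; rewrite (sublinear0 ss).
      by exists a => //; have [ss _] := svalP a; rewrite (sublinear0 ss).
  have Sq x : inf (S x) <= q x.
    by rewrite (le_trans (iS _ _ Aa))//; have [_ ->] := svalP a.
  pose t : T := exist _ (fun x => inf (S x)) (conj sS Sq).
  by exists t => s As; apply/asboolP => x; exact: iS.
exists g; split=> // q' sq' q'g x.
have q'q y : q' y <= q y by exact: le_trans (gq y).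
pose t : T := exist _ q' (conj sq' q'q).
by have /asboolP/(_ x) := gmax t (asboolT q'g).
Qed.

(** A minimal sublinear functional below [cone_inf q K] is linear, and its bound at [- k.1] is the
    constraint of [k]. *)
Theorem hahn_banach_cone (q : V -> R) (K : set (V * R)) :
  sublinear q -> pair_cone K -> (forall k, K k -> k.2 <= q k.1) ->
  exists g : V -> R^o, [/\ linear g, forall x, g x <= q x &
    forall k, K k -> k.2 <= g k.1].
Proof.
move=> sq cK Kq.
have [g [sg gq gmin]] := exists_minimal_sublinear (cone_inf_sublinear sq cK Kq).
have lg := minimal_sublinear_linear sg gmin.
exists g; split=> // [x|k Kk].
  by rewrite (le_trans (gq x))//; exact: cone_inf_leq.
have := le_trans (gq (- k.1)) (cone_infN sq Kq Kk).
by rewrite linear_funN// lerN2.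
Qed.

Corollary hahn_banach_at (q : V -> R) (z : V) : sublinear q ->
  exists g : V -> R^o, [/\ linear g, forall x, g x <= q x & g z = q z].
Proof.
move=> sq.
have [g [lg gq gK]] :=
  hahn_banach_cone sq (ray_cone q z) (fun k => @ray_le q z k sq).
exists g; split=> //; apply/eqP; rewrite eq_le gq/=.
exact: gK (ray1 q z).
Qed.

End hahn_banach.

(** * Riesz spaces *)

Definition riesz_pos (R : realType) (V : rieszType R) (x : V) : V := x \v 0.

Section riesz_theory.
Variables (R : realType) (V : rieszType R).
Implicit Types x y z t : V.

Lemma rlerD2l z x y : (z + x <= z + y) = (x <= y).
Proof.
apply/idP/idP => [|h]; last exact: riesz_lerD2l.
by move=> /(riesz_lerD2l (- z)); rewrite !addKr.
Qed.

Lemma rlerD2r z x y : (x + z <= y + z) = (x <= y).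
Proof. by rewrite ![_ + z]addrC rlerD2l. Qed.

Lemma rsubr_ge0 x y : (0 <= y - x) = (x <= y).
Proof. by rewrite -[LHS](rlerD2r x) add0r subrK. Qed.

Lemma rlerD x y z t : x <= y -> z <= t -> x + z <= y + t.
Proof. by move=> xy zt; rewrite (@le_trans _ _ (y + z)) ?rlerD2r ?rlerD2l. Qed.

Lemma raddr_ge0 x y : 0 <= x -> 0 <= y -> 0 <= x + y.
Proof. by move=> x0 y0; rewrite -[0]addr0 rlerD. Qed.

Lemma rlerN2 x y : (- x <= - y) = (y <= x).
Proof. by rewrite -[LHS]rsubr_ge0 opprK addrC rsubr_ge0. Qed.

Lemma rlerNl x y : (- x <= y) = (- y <= x).
Proof. by rewrite -[y in LHS]opprK rlerN2. Qed.

Lemma rlerNr x y : (x <= - y) = (y <= - x).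
Proof. by rewrite -[x in LHS]opprK rlerN2. Qed.

Lemma rlerBlDr x y z : (x - y <= z) = (x <= z + y).
Proof. by rewrite -[LHS](rlerD2r y) subrK. Qed.

Lemma rlerBrDr x y z : (x <= y - z) = (x + z <= y).
Proof. by rewrite -[LHS](rlerD2r z) subrK. Qed.

Lemma rlerBrDl x y z : (x <= y - z) = (z + x <= y).
Proof. by rewrite rlerBrDr addrC. Qed.

Lemma rlerZ2l (a : R) x y : 0 <= a -> x <= y -> a *: x <= a *: y.
Proof.
move=> a0; rewrite -rsubr_ge0 => xy; rewrite -rsubr_ge0 -scalerBr.
exact: riesz_scaler_ge0.
Qed.

Lemma join_ubl x y : x <= x \v y.
Proof. by have := lexx (x \v y); rewrite riesz_leUx => /andP[]. Qed.

Lemma join_ubr x y : y <= x \v y.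
Proof. by have := lexx (x \v y); rewrite riesz_leUx => /andP[]. Qed.

Lemma join_lub x y z : x <= z -> y <= z -> x \v y <= z.
Proof. by rewrite riesz_leUx => -> ->. Qed.

Lemma meet_lbl x y : x \^ y <= x.
Proof. by have := lexx (x \^ y); rewrite riesz_lexI => /andP[]. Qed.

Lemma meet_lbr x y : x \^ y <= y.
Proof. by have := lexx (x \^ y); rewrite riesz_lexI => /andP[]. Qed.

Lemma meet_glb x y z : z <= x -> z <= y -> z <= x \^ y.
Proof. by rewrite riesz_lexI => -> ->. Qed.

Lemma riesz_joinC x y : x \v y = y \v x.
Proof. by apply/eqP; rewrite eq_le !riesz_leUx !join_ubl !join_ubr. Qed.

Lemma join_le x y z t : x <= z -> y <= t -> x \v y <= z \v t.
Proof.
move=> xz yt; rewrite riesz_leUx (le_trans xz (join_ubl _ _)).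
by rewrite (le_trans yt (join_ubr _ _)).
Qed.

Lemma riesz_join_l x y : y <= x -> x \v y = x.
Proof. by move=> yx; apply/eqP; rewrite eq_le riesz_leUx lexx yx join_ubl. Qed.

Lemma riesz_join_r x y : x <= y -> x \v y = y.
Proof. by move=> xy; rewrite riesz_joinC riesz_join_l. Qed.

Lemma joinDr x y z : (x \v y) + z = (x + z) \v (y + z).
Proof.
apply/eqP; rewrite eq_le riesz_leUx !rlerD2r join_ubl join_ubr !andbT.
by rewrite -rlerBrDr riesz_leUx !rlerBrDr join_ubl join_ubr.
Qed.

Lemma oppr_join x y : - (x \v y) = (- x) \^ (- y).
Proof.
apply/eqP; rewrite eq_le riesz_lexI !rlerN2 join_ubl join_ubr/=.
by rewrite rlerNr riesz_leUx ![_ <= - (_ \^ _)]rlerNr meet_lbl meet_lbr.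
Qed.

Lemma joinD_meet x y : (x \v y) + (x \^ y) = x + y.
Proof.
have -> : x \^ y = - ((- x) \v (- y)) by rewrite oppr_join !opprK.
apply/eqP; rewrite subr_eq addrC joinDr.
by rewrite addKr addrCA addNr addr0 riesz_joinC.
Qed.

Lemma meetE x y : x \^ y = x + y - (x \v y).
Proof. by rewrite -[x + y]joinD_meet addrAC subrr add0r. Qed.

Lemma join_pos x y : x \v y = riesz_pos (x - y) + y.
Proof. by rewrite /riesz_pos joinDr subrK add0r. Qed.

Lemma meet_pos x y : x \^ y = x - riesz_pos (x - y).
Proof. by rewrite meetE join_pos opprD addrA addrAC addrK. Qed.

Lemma pos_ge0 x : 0 <= riesz_pos x. Proof. exact: join_ubr. Qed.

Lemma pos_ge x : x <= riesz_pos x. Proof. exact: join_ubl. Qed.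

Lemma pos_le x y : x <= y -> riesz_pos x <= riesz_pos y.
Proof. by move=> xy; exact: join_le. Qed.

Lemma pos_lub x y : x <= y -> 0 <= y -> riesz_pos x <= y.
Proof. exact: join_lub. Qed.

Lemma ge0_pos x : 0 <= x -> riesz_pos x = x.
Proof. exact: riesz_join_l. Qed.

Lemma le0_pos x : x <= 0 -> riesz_pos x = 0.
Proof. exact: riesz_join_r. Qed.

Lemma pos0 : riesz_pos (0 : V) = 0. Proof. exact: ge0_pos. Qed.

Lemma posBl x : riesz_pos x - x = riesz_pos (- x).
Proof. by rewrite /riesz_pos joinDr subrr add0r riesz_joinC. Qed.

Lemma posB x : riesz_pos x - riesz_pos (- x) = x.
Proof. by rewrite -posBl opprB addrC subrK. Qed.

Lemma pos_subadd x y : riesz_pos (x + y) <= riesz_pos x + riesz_pos y.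
Proof.
apply: pos_lub; first exact: rlerD (pos_ge _) (pos_ge _).
by rewrite raddr_ge0 ?pos_ge0.
Qed.

Lemma posZ (a : R) x : 0 <= a -> riesz_pos (a *: x) = a *: riesz_pos x.
Proof.
have sub (b : R) y : 0 <= b -> riesz_pos (b *: y) <= b *: riesz_pos y.
  move=> b0; rewrite pos_lub ?riesz_scaler_ge0 ?pos_ge0//.
  exact: rlerZ2l (pos_ge y).
rewrite le_eqVlt => /predU1P[<-|a0]; first by rewrite !scale0r pos0.
have a0' := ltW a0; apply/eqP; rewrite eq_le sub//=.
have := @sub a^-1 (a *: x); rewrite invr_ge0 a0' scalerA mulVf ?gt_eqF//.
move=> /(_ isT) /(rlerZ2l a0').
by rewrite scale1r scalerA divff ?gt_eqF// scale1r.
Qed.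

Lemma absE x : riesz_abs x = riesz_pos x + riesz_pos (- x).
Proof.
(* Translating by [x] turns [x \v - x] into [(x + x) \v 0], twice the positive part. *)
have e : riesz_abs x + x = riesz_pos x + riesz_pos x.
  rewrite /riesz_abs joinDr addNr -mulr2n -scaler_nat -/(riesz_pos _).
  by rewrite posZ// scaler_nat mulr2n.
by rewrite -posBl addrA -e addrK.
Qed.

Lemma abs_ge0 x : 0 <= riesz_abs x.
Proof. by rewrite absE raddr_ge0 ?pos_ge0. Qed.

Lemma abs_ge x : x <= riesz_abs x. Proof. exact: join_ubl. Qed.

Lemma abs_geN x : - x <= riesz_abs x. Proof. exact: join_ubr. Qed.

Lemma abs_lub x y : x <= y -> - x <= y -> riesz_abs x <= y.
Proof. exact: join_lub. Qed.

Lemma absN x : riesz_abs (- x) = riesz_abs x.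
Proof. by rewrite /riesz_abs opprK riesz_joinC. Qed.

Lemma ge0_abs x : 0 <= x -> riesz_abs x = x.
Proof.
by move=> x0; apply: riesz_join_l; rewrite (le_trans _ x0)// rlerNl oppr0.
Qed.

Lemma abs_abs x : riesz_abs (riesz_abs x) = riesz_abs x.
Proof. by rewrite ge0_abs// abs_ge0. Qed.

Lemma abs_subadd x y : riesz_abs (x + y) <= riesz_abs x + riesz_abs y.
Proof.
apply: abs_lub; first exact: rlerD (abs_ge x) (abs_ge y).
by rewrite opprD; exact: rlerD (abs_geN x) (abs_geN y).
Qed.

Lemma absZ (a : R) x : riesz_abs (a *: x) = `|a| *: riesz_abs x.
Proof.
have [a0|a0] := leP 0 a.
  by rewrite ger0_norm// !absE -scalerN !posZ// -scalerDr.
have Na0 : 0 <= - a by rewrite oppr_ge0 ltW.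
by rewrite ltr0_norm// -absN -scaleNr !absE -scalerN !posZ// -scalerDr.
Qed.

Lemma pos_le_abs x : riesz_pos x <= riesz_abs x.
Proof. by rewrite pos_lub ?abs_ge ?abs_ge0. Qed.

Lemma abs_eq0 x : riesz_abs x = 0 -> x = 0.
Proof.
move=> x0; apply/eqP; rewrite eq_le -{1}x0 abs_ge/=.
by rewrite -[x]opprK -[0]oppr0 rlerN2 -x0 abs_geN.
Qed.

End riesz_theory.

(** * Duals of locally convex-solid Riesz spaces *)

Section dual_theory.
Variables (R : realType) (E : preTopologicalLmodType R).
Implicit Types (f g : dual E) (x y : E).

Lemma dual_linear f : linear (f : E -> R^o).
Proof. by have := valP f; rewrite unfold_in inE => -[]. Qed.

Lemma dual_continuous f : continuous (f : E -> R^o).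
Proof. by have := valP f; rewrite unfold_in inE => -[]. Qed.

Lemma dual_add f x y : f (x + y) = f x + f y.
Proof. by have := dual_linear f 1 x y; rewrite !scale1r. Qed.

Lemma dual_apply0 f : f 0 = 0.
Proof. by apply: (addrI (f 0)); rewrite -dual_add !addr0. Qed.

Lemma dual_scale f (a : R) x : f (a *: x) = a * f x.
Proof. by have := dual_linear f a x 0; rewrite !addr0 dual_apply0 addr0. Qed.

Lemma dual_opp f x : f (- x) = - f x.
Proof. by rewrite -scaleN1r dual_scale mulN1r. Qed.

Lemma dual_sub f x y : f (x - y) = f x - f y.
Proof. by rewrite dual_add dual_opp. Qed.

Lemma dualDE f g x : (f + g : dual E) x = f x + g x. Proof. by []. Qed.

Lemma dual0E x : (0 : dual E) x = 0. Proof. by []. Qed.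

Lemma dualZE (a : R) f x : (a *: f : dual E) x = a * f x. Proof. by []. Qed.

Lemma dualNE f x : (- f : dual E) x = - f x. Proof. by []. Qed.

Lemma dualBE f g x : (f - g : dual E) x = f x - g x. Proof. by []. Qed.

Lemma dual_ext f g : (forall x, f x = g x) -> f = g.
Proof. by move=> fg; apply: val_inj; apply/funext. Qed.

Lemma exists_dual (h : E -> R^o) : linear h -> continuous h ->
  exists f : dual E, forall x, f x = h x.
Proof.
move=> lh ch.
have hP : h \in @dual_pred R E by rewrite unfold_in inE.
by exists (exist _ h hP).
Qed.

End dual_theory.

Lemma tvs_linear_continuous (R : realType) (M : tvsType R) (f : M -> R^o) :
  linear f -> nbhs 0 [set x | `|f x| < 1] -> continuous f.
Proof.
move=> lf f1 x; apply/cvgrPdist_lt => e e0.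
have := nbhsT x (nbhs0Z (lt0r_neq0 e0) f1).
apply: filterS => _ [_ [y /= fy <-] <-].
have f0 := linear_fun0 lf.
have -> : f (x + e *: y) = f x + e * f y.
  have fe : f (e *: y) = e * f y by have := lf e y 0; rewrite !addr0 f0 addr0.
  by have := lf 1 x (e *: y); rewrite !scale1r fe.
by rewrite opprD addNKr normrN normrM gtr0_norm// gtr_pMr.
Qed.

(** * Riesz seminorms and continuity *)

Section riesz_seminorm_theory.
Variables (R : realType) (V : rieszType R).
Implicit Types p q : V -> R.

Lemma seminorm0 p : riesz_seminorm p -> p 0 = 0.
Proof. by case=> _ /(_ 0 0); rewrite scale0r normr0 mul0r. Qed.

Lemma seminormN p x : riesz_seminorm p -> p (- x) = p x.
Proof. by case=> _ /(_ (-1) x); rewrite scaleN1r normrN1 mul1r. Qed.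

Lemma seminorm_ge0 p x : riesz_seminorm p -> 0 <= p x.
Proof.
move=> sp; have [pD _ _] := sp.
by have := pD x (- x); rewrite subrr seminormN// seminorm0//; lra.
Qed.

Lemma seminorm_abs p x : riesz_seminorm p -> p (riesz_abs x) = p x.
Proof. by case=> _ _ pm; apply/eqP; rewrite eq_le !pm ?abs_abs. Qed.

Lemma seminorm_le p x y : riesz_seminorm p -> 0 <= x -> x <= y -> p x <= p y.
Proof.
by case=> _ _ pm x0 xy; rewrite pm// !ge0_abs// (le_trans x0).
Qed.

Lemma seminorm_sublinear p : riesz_seminorm p -> sublinear p.
Proof. by case=> pD pZ _; split=> // a x a0; rewrite pZ ger0_norm. Qed.

Lemma seminorm_pos_sublinear p : riesz_seminorm p ->
  sublinear (fun x => p (riesz_pos x)).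
Proof.
move=> sp; have [pD pZ pm] := sp; split=> [x y|a x a0].
  rewrite (le_trans _ (pD _ _))// seminorm_le// ?pos_ge0//.
  exact: pos_subadd.
by rewrite posZ// pZ ger0_norm.
Qed.

Lemma seminormD p q : riesz_seminorm p -> riesz_seminorm q ->
  riesz_seminorm (fun x => p x + q x).
Proof.
move=> [pD pZ pm] [qD qZ qm]; split=> [x y|a x|x y xy].
- by rewrite addrACA lerD.
- by rewrite pZ qZ mulrDr.
- by rewrite lerD ?pm ?qm.
Qed.

Lemma seminormZ (a : R) p : 0 <= a -> riesz_seminorm p ->
  riesz_seminorm (fun x => a * p x).
Proof.
move=> a0 [pD pZ pm]; split=> [x y|b x|x y xy].
- by rewrite -mulrDr ler_wpM2l.
- by rewrite pZ mulrCA.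
- by rewrite ler_wpM2l// pm.
Qed.

Lemma seminorm_cst0 : riesz_seminorm (fun _ : V => 0 : R).
Proof. by split=> // *; rewrite ?addr0 ?mulr0. Qed.

End riesz_seminorm_theory.

Section lcs_riesz.
Variables (R : realType) (V : lcsRieszType R).

Definition cont_seminorm (p : V -> R) : Prop :=
  riesz_seminorm p /\ nbhs 0 [set x | p x < 1].

Lemma cont_seminorm_nbhs p x (e : R) : cont_seminorm p -> 0 < e ->
  nbhs x [set y | p (y - x) < e].
Proof.
move=> [[_ pZ _] p1] e0.
have := nbhsT x (nbhs0Z (lt0r_neq0 e0) p1); apply: filterS.
move=> _ [_ [y /= py <-] <-].
by rewrite addrC addKr pZ gtr0_norm// gtr_pMr.
Qed.

Lemma cont_seminorm_nbhs0 p (e : R) : cont_seminorm p -> 0 < e ->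
  nbhs 0 [set y | p y < e].
Proof.
move=> cp e0; have := cont_seminorm_nbhs 0 cp e0.
by apply: filterS => y /=; rewrite subr0.
Qed.

Lemma cont_seminormD p q : cont_seminorm p -> cont_seminorm q ->
  cont_seminorm (fun x => p x + q x).
Proof.
move=> cp cq; split; first by apply: seminormD; [case: cp|case: cq].
have h : 0 < 2^-1 :> R by rewrite invr_gt0.
apply: filterS2 (cont_seminorm_nbhs0 cp h) (cont_seminorm_nbhs0 cq h) => x /=.
lra.
Qed.

Lemma cont_seminormZ (a : R) p : 0 <= a -> cont_seminorm p ->
  cont_seminorm (fun x => a * p x).
Proof.
move=> a0 cp; split; first by apply: seminormZ => //; case: cp.
have h : 0 < (a + 1)^-1 by rewrite invr_gt0; lra.
apply: filterS (cont_seminorm_nbhs0 cp h) => x /= px.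
rewrite (@le_lt_trans _ _ ((a + 1) * p x))//.
  by rewrite ler_wpM2r//; [case: cp => sp _; exact: seminorm_ge0|lra].
by rewrite mulrC -ltr_pdivlMr ?div1r//; lra.
Qed.

Lemma cont_seminorm_cst0 : cont_seminorm (fun=> 0).
Proof.
split; first exact: seminorm_cst0.
by apply: filterS filterT => x _ /=; exact: ltr01.
Qed.

(** The sum of finitely many generating seminorms dominates each of them; rescaled by [e^-1], it
    describes the neighborhood by a single unit ball. *)
Lemma nbhs_cont_seminorm (U : set V) : nbhs 0 U ->
  exists2 p, cont_seminorm p & [set x | p x < 1] `<=` U.
Proof.
have [P [Psn Pgen]] := @lcs_riesz_seminorms R V.
have Pc p : P p -> cont_seminorm p.
  move=> Pp; split; first exact: Psn.
  apply/Pgen; exists [set p], 1; split=> //; first by move=> _ ->.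
  by move=> y /= /(_ p erefl); rewrite subr0.
move=> /Pgen[F [e [finF FP e0 FU]]].
have [q cq Fq] : exists2 q, cont_seminorm q & forall p, F p ->
    forall x, p x <= q x.
  have [s Fs] := (finite_seqP F).1 finF.
  have {}FP p : p \in s -> P p by move=> ps; apply: FP; rewrite Fs.
  suff [q cq sq] : exists2 q, cont_seminorm q &
      forall p, p \in s -> forall x, p x <= q x.
    by exists q => // p; rewrite Fs; exact: sq.
  elim: s FP {Fs} => [|p s ih] FP.
    by exists (fun=> 0) => //; exact: cont_seminorm_cst0.
  have [|q cq sq] := ih; first by move=> r rs; apply: FP; rewrite inE rs orbT.
  have Pp : cont_seminorm p by apply/Pc/FP; rewrite inE eqxx.
  exists (fun x => p x + q x); first exact: cont_seminormD.
  move=> r; rewrite inE => /predU1P[->|rs] x.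
    by rewrite lerDl; case: cq => + _; exact: seminorm_ge0.
  rewrite (le_trans (sq _ rs x))// lerDr.
  by case: Pp => + _; exact: seminorm_ge0.
exists (fun x => e^-1 * q x).
  by apply: cont_seminormZ; rewrite ?invr_ge0 ?ltW.
move=> x /=; rewrite mulrC ltr_pdivrMr// mul1r => qx; apply: FU => p Fp /=.
by rewrite subr0 (le_lt_trans (Fq _ Fp x)).
Qed.

Lemma dual_le_seminorm (f : dual V) :
  exists2 p, cont_seminorm p & forall x, `|f x| <= p x.
Proof.
have f1 : nbhs 0 [set x | `|f x| < 1].
  have /cvgrPdist_lt/(_ 1 ltr01) := @dual_continuous _ _ f 0.
  by apply: filterS => x /=; rewrite dual_apply0 sub0r normrN.
have [p cp pf] := nbhs_cont_seminorm f1; exists p => // x.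
have [[_ pZ _] _] := cp; have p0 := seminorm_ge0 x cp.1.
apply/ler_addgt0Pr => e e0; have d0 : 0 < p x + e by lra.
(* The slack [e] allows this normalization even when [p x = 0]. *)
have := pf ((p x + e)^-1 *: x); rewrite /= pZ dual_scale normrM.
rewrite gtr0_norm ?invr_gt0// ![_^-1 * _]mulrC !ltr_pdivrMr// !mul1r.
by move=> h; apply/ltW/h; lra.
Qed.

Lemma seminorm_exists_dual p (h : V -> R^o) : cont_seminorm p -> linear h ->
  (forall x, `|h x| <= p x) -> exists f : dual V, forall x, f x = h x.
Proof.
move=> [sp p1] lh hp; apply: exists_dual => //.
apply: tvs_linear_continuous => //.
by apply: filterS p1 => x /=; exact: le_lt_trans.
Qed.

Lemma tvs_boundedP (A : set V) : tvs_bounded A <->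
  forall p, cont_seminorm p -> exists M, forall x, A x -> p x <= M.
Proof.
split=> [bA p [sp p1]|bA U /nbhs_cont_seminorm[p cp pU]].
  have := bA _ p1; move=> [M [_ MA]].
  have [_ pZ _] := sp.
  exists (`|M| + 1) => x /(MA (`|M| + 1)).
  have h : 0 < `|M| + 1 by rewrite ltr_wpDl.
  case; first by rewrite (le_lt_trans (ler_norm M))// ltrDl.
  move=> y /= py <-; rewrite pZ gtr0_norm// -[leRHS]mulr1.
  by rewrite ler_wpM2l// ltW.
have [M MA] := bA _ cp; have [[_ pZ _] _] := cp.
near=> r.
have r0 : 0 < r by near: r; exact: nbhs_pinfty_gt.
move=> x Ax; exists (r^-1 *: x); last first.
  by rewrite scalerA divff ?gt_eqF// scale1r.
apply: pU => /=; rewrite pZ gtr0_norm ?invr_gt0// mulrC ltr_pdivrMr// mul1r.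
rewrite (le_lt_trans (MA _ Ax))//.
by near: r; apply: nbhs_pinfty_gt; exact: num_real.
Unshelve. all: by end_near. Qed.

End lcs_riesz.

(** * Positive functionals *)

Section positive_functionals.
Variables (R : realType) (V : lcsRieszType R).
Implicit Types (f g : dual V) (x y z : V).

Lemma dual_ge0_le f x y : dual_ge0 f -> x <= y -> f x <= f y.
Proof. by move=> f0; rewrite -rsubr_ge0 => /f0; rewrite dual_sub subr_ge0. Qed.

Lemma dual_ge0D f g : dual_ge0 f -> dual_ge0 g -> dual_ge0 (f + g).
Proof. by move=> f0 g0 x x0; rewrite dualDE addr_ge0 ?f0 ?g0. Qed.

Lemma dual_ge0Z (a : R) f : 0 <= a -> dual_ge0 f -> dual_ge0 (a *: f).
Proof. by move=> a0 f0 x x0; rewrite dualZE mulr_ge0 ?f0. Qed.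

Lemma dual_ge00 : dual_ge0 (0 : dual V).
Proof. by move=> x _; rewrite dual0E. Qed.

(** A linear functional below the sublinear [x |-> f (riesz_pos x)] is at most [f] on the positive
    cone, and positive because the bound vanishes at negative elements. Hahn-Banach makes it exact
    at [z]. This replaces the lattice structure of the dual in what follows. *)
Lemma exists_dual_split f z : dual_ge0 f ->
  exists g : dual V, [/\ dual_ge0 g, dual_ge0 (f - g) & g z = f (riesz_pos z)].
Proof.
move=> f0; pose q x : R := f (riesz_pos x).
have sq : sublinear q.
  split=> [x y|a x a0]; rewrite /q.
    by rewrite -dual_add dual_ge0_le ?pos_subadd.
  by rewrite posZ// dual_scale.
have [h [lh hq hz]] := hahn_banach_at z sq.
have [p cp fp] := dual_le_seminorm f; have [sp _] := cp.
have [|g gh] := seminorm_exists_dual cp lh.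
  apply: linear_bound_abs => // x; first exact: seminormN.
  rewrite (le_trans (hq x))// /q.
  rewrite (le_trans (ler_norm _))// (le_trans (fp _))//.
  by rewrite -(seminorm_abs x sp) seminorm_le ?pos_ge0 ?pos_le_abs.
exists g; split; last by rewrite gh hz.
- move=> x x0; have := hq (- x); rewrite /q le0_pos; last first.
    by rewrite rlerNl oppr0.
  by rewrite dual_apply0 -gh dual_opp oppr_le0.
- by move=> x x0; rewrite dualBE subr_ge0 gh (le_trans (hq x))// /q ge0_pos.
Qed.

(** Using [p (riesz_pos x)] instead of [p x] as the sublinear bound makes the norming functional
    positive. *)
Lemma exists_dual_norming (p : V -> R) z : cont_seminorm p -> 0 <= z ->
  exists f : dual V, [/\ dual_ge0 f, forall x, `|f x| <= p x & f z = p z].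
Proof.
move=> cp z0; have [sp _] := cp.
have [h [lh hq hz]] := hahn_banach_at z (seminorm_pos_sublinear sp).
have hp x : `|h x| <= p x.
  apply: linear_bound_abs => // {}x; first exact: seminormN.
  rewrite (le_trans (hq x))//.
  by rewrite -[leRHS]seminorm_abs// seminorm_le ?pos_ge0 ?pos_le_abs.
have [f fh] := seminorm_exists_dual cp lh hp.
exists f; split=> [x x0|x|]; rewrite ?fh//; last by rewrite hz ge0_pos.
have := hq (- x); rewrite le0_pos; last by rewrite rlerNl oppr0.
by rewrite seminorm0// -!fh dual_opp oppr_le0.
Qed.

(** The constraints [f y <= g (y + u)] for [y, u >= 0] contain both [0 <= g] (take [y = 0]) and
    [f <= g] (take [u = 0]). They are compatible with the bound [p] because [p] is monotone on the
    positive cone. *)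
Lemma dual_jordan f :
  exists g h : dual V, [/\ dual_ge0 g, dual_ge0 h & f = g - h].
Proof.
have [p cp fp] := dual_le_seminorm f; have [sp _] := cp.
pose K : set (V * R) := [set k | exists y u : V,
  [/\ 0 <= y, 0 <= u & k = (y + u, f y)]].
have cK : pair_cone K.
  split.
  - by exists 0, 0; split; rewrite // ?addr0 ?dual_apply0.
  - move=> _ _ [y [u [y0 u0 ->]]] [y' [u' [y'0 u'0 ->]]].
    exists (y + y'), (u + u'); rewrite !raddr_ge0//; split=> //.
    by rewrite dual_add addrACA.
  - move=> a _ a0 [y [u [y0 u0 ->]]]; exists (a *: y), (a *: u).
    have a0' := ltW a0; rewrite !riesz_scaler_ge0//; split=> //.
    by rewrite /= scalerDr dual_scale.
have Kp k : K k -> k.2 <= p k.1.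
  move=> [y [u [y0 u0 ->]]] /=.
  rewrite (le_trans (ler_norm _))// (le_trans (fp y))// seminorm_le//.
  by rewrite -[X in X <= _]addr0 rlerD2l.
have [h [lh hp hK]] := hahn_banach_cone (seminorm_sublinear sp) cK Kp.
have [g gh] := seminorm_exists_dual cp lh
  (linear_bound_abs lh (fun x => seminormN x sp) hp).
exists g, (g - f); split=> [u u0|y y0|].
- rewrite gh; have := hK (0 + u, f 0); rewrite dual_apply0 /= add0r; apply.
  by exists 0, u; rewrite dual_apply0 add0r.
- rewrite dualBE subr_ge0 gh; have := hK (y + 0, f y); rewrite /= addr0; apply.
  by exists y, 0; rewrite addr0.
- by rewrite opprB addrC subrK.
Qed.

Lemma hausdorff_seminorm0 x : (forall p, cont_seminorm p -> p x = 0) -> x = 0.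
Proof.
move=> x0; apply: (@lcs_riesz_hausdorff R V) => A B Ax B0.
exists x; split; first exact: nbhs_singleton.
have [p cp pB] := nbhs_cont_seminorm B0.
by apply: pB; rewrite /= x0.
Qed.

(** If [f] norms the negative part of [x] for [p], splitting [f] at [- x] gives a positive [g] with
    [g (- x) = p (riesz_pos (- x))], while [g (- x) <= 0] by hypothesis. *)
Lemma dual_sep_ge0 x : (forall f, dual_ge0 f -> 0 <= f x) -> 0 <= x.
Proof.
move=> fx; suff xn0 : riesz_pos (- x) = 0 by rewrite -[x]posB xn0 subr0 pos_ge0.
apply: hausdorff_seminorm0 => p cp.
have [f [f0 _ <-]] := exists_dual_norming cp (pos_ge0 (- x)).
have [g [g0 fg0 gx]] := exists_dual_split (- x) f0.
apply/eqP; rewrite eq_le f0 ?pos_ge0// andbT -gx dual_opp oppr_le0.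
exact: fx.
Qed.

Lemma dual_sep_le x y : (forall f, dual_ge0 f -> f x <= f y) -> x <= y.
Proof.
move=> fxy; rewrite -rsubr_ge0; apply: dual_sep_ge0 => f f0.
by rewrite dual_sub subr_ge0 fxy.
Qed.

Lemma dual_norm_le_abs f x : dual_ge0 f -> `|f x| <= f (riesz_abs x).
Proof.
move=> f0; rewrite ler_norml (dual_ge0_le f0 (abs_ge x)) andbT.
by rewrite lerNl -dual_opp dual_ge0_le ?abs_geN.
Qed.

End positive_functionals.

(** * Order and boundedness in the bidual *)

Section bidual_order.
Variables (R : realType) (V : lcsRieszType R).
Implicit Types (phi psi : bidual V).

Lemma bidual_le_trans phi psi theta : bidual_le phi psi ->
  bidual_le psi theta -> bidual_le phi theta.
Proof. by move=> h k f f0; exact: le_trans (h f f0) (k f f0). Qed.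

Lemma bidual_ext phi psi : (forall f, dual_ge0 f -> phi f = psi f) -> phi = psi.
Proof.
move=> e; apply: dual_ext => f.
by have [g [h [g0 h0 ->]]] := dual_jordan f; rewrite !dual_sub !e.
Qed.

(** Splitting [f] at [x - y] yields [f (x \v y) = g x + (f - g) y] with [g] and [f - g] positive,
    and [phi] dominates each term. Hence joins taken in the space are least upper bounds in the
    whole bidual. *)
Lemma bidual_le_join phi (x y : V) : bidual_le (bidual_embed x) phi ->
  bidual_le (bidual_embed y) phi -> bidual_le (bidual_embed (x \v y)) phi.
Proof.
move=> xphi yphi f f0; have [g [g0 fg0 gz]] := exists_dual_split (x - y) f0.
have -> : phi f = phi g + phi (f - g) by rewrite -dual_add addrC subrK.
apply: le_trans (lerD (xphi g g0) (yphi (f - g) fg0)).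
rewrite -[leLHS]/(f (x \v y)) -[leRHS]/(g x + (f - g : dual V) y).
by rewrite join_pos dual_add -gz dual_sub dualBE addrA addrAC.
Qed.

(* Functionals dominated by [e p] tend to 0 strongly as [e] tends to 0. *)
Lemma bidual_small_polar phi (p : V -> R) : cont_seminorm p ->
  exists2 e : R, 0 < e &
    forall f : dual V, (forall x, `|f x| <= e * p x) -> `|phi f| < 1.
Proof.
move=> cp.
pose B (e : R) := [set f : dual V | forall x, `|f x| <= e * p x].
pose F := filter_from [set e : R | 0 < e] B.
have pge0 x : 0 <= p x by apply: seminorm_ge0; case: cp.
have FF : Filter F.
  apply: filter_from_filter; first by exists 1; exact: ltr01.
  move=> d e /= d0 e0; exists (Num.min d e); first by rewrite /= lt_min d0.
  move=> f fB; split=> x; rewrite (le_trans (fB x))// ler_wpM2r//.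
    by rewrite ge_min lexx.
  by rewrite ge_min lexx orbT.
have F0 : F --> (0 : dual V).
  move=> U [_ [[W oW <-] W0 WU]].
  have : {family tvs_bounded (E := V),
      (fun f : dual V => f : V -> R^o) @ F --> ((0 : dual V) : V -> R^o)}.
    apply/fam_cvgP => A bA P /uniform_nbhs[D [entD DP]].
    have /nbhs_ballP[d /= d0 dD] : nbhs (0 : R^o) (xsection D 0).
      by apply/nbhsP; exists D.
    have [M MA] := (tvs_boundedP A).1 bA p cp.
    (* [M] may fail to be positive, and [M'] serves as a divisor. *)
    pose M' := Num.max M 1.
    have M'0 : 0 < M' by rewrite lt_max ltr01 orbT.
    have e0 : 0 < d / 2 / M' by rewrite !divr_gt0.
    exists (d / 2 / M') => // f fB; apply: DP => x Ax; apply/xsectionP.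
    apply: dD; rewrite /ball /= sub0r normrN (le_lt_trans (fB x))//.
    rewrite (@le_lt_trans _ _ (d / 2))//; last by lra.
    have d20 : 0 <= d / 2 by lra.
    rewrite mulrAC ler_pdivrMr// ler_wpM2l//.
    by rewrite (le_trans (MA _ Ax))// le_max lexx.
  move=> /(_ W); rewrite nbhsE => h.
  have [e e0 eW] : F [set f : dual V | W (f : V -> R^o)].
    by apply: h; exists W => //; split.
  by exists e => // f /eW /WU.
have /cvgrPdist_lt/(_ 1 ltr01) := cvg_trans (cvg_app phi F0)
  (@dual_continuous _ _ phi 0).
move=> [e e0 eB]; exists e => // f /eB /=.
by rewrite dual_apply0 sub0r normrN.
Qed.

(** With [f] norming [x] for [p], the multiple [e *: f] lies in the polar on which [phi] is less
    than 1, so [p x = f x <= phi f <= e^-1]. *)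
Lemma bidual_le_bounded phi :
  tvs_bounded [set x : V | 0 <= x /\ bidual_le (bidual_embed x) phi].
Proof.
apply/tvs_boundedP => p cp; have [e e0 eB] := bidual_small_polar phi cp.
exists e^-1 => x [x0 xphi].
have [f [f0 fp <-]] := exists_dual_norming cp x0.
have := eB (e *: f); rewrite dual_scale normrM gtr0_norm// => h.
have /ltW : e * `|phi f| < 1.
  by apply: h => y; rewrite dualZE normrM gtr0_norm// ler_wpM2l// ltW.
rewrite -ler_pdivlMl// mulr1; apply: le_trans.
by rewrite (le_trans (xphi f f0))// ler_norm.
Qed.

(** The last hypothesis bounds [h] by the uniform norm on the bounded set [D], which is a continuous
    seminorm for the strong topology. *)
Lemma exists_bidual (h : dual V -> R^o) (D : set V) : linear h ->
  tvs_bounded D -> (forall (f : dual V) (e : R), 0 < e ->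
    (forall x, D x -> `|f x| <= e) -> `|h f| <= e) ->
  exists phi : bidual V, forall f : dual V, phi f = h f.
Proof.
move=> lh bD hD; apply: exists_dual => // f.
apply/(@cvgrPdist_lt _ R^o _ _ (nbhs_filter (f : dual V))) => e e0.
have e20 : 0 < e / 2 by rewrite divr_gt0.
have ent : entourage [set xy : R^o * R^o | `|xy.1 - xy.2| < e / 2].
  by rewrite -entourage_ballE; exists (e / 2).
pose incl (g : dual V) : {family tvs_bounded (E := V), V -> R^o} := dual_fun g.
have icont : incl @ nbhs (f : dual V) --> incl f.
  exact: (@initial_continuous (dual V) _ incl f).
have := icont _ (@fam_nbhs _ _ _ D _ (incl f) ent bD).
rewrite /= nbhs_simpl.
apply: (@filterS _ _ (nbhs_filter (f : dual V))) => g /= fg.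
have -> : h f - h g = h (f - g).
  by have := lh (-1) g f; rewrite !scaleN1r [- g + f]addrC => ->; exact: addrC.
rewrite (@le_lt_trans _ _ (e / 2))//; last by lra.
by apply: hD => // x Dx; rewrite dualBE ltW// fg.
Qed.

End bidual_order.

(** * Suprema of directed families *)

Lemma net_tails_proper (I : Type) (leI : I -> I -> Prop) :
  directed leI -> ProperFilter (net_tails leI).
Proof.
move=> [[i0] refl trans dir]; apply: filter_from_proper.
  apply: filter_from_filter; first by exists i0.
  move=> i j _ _; have [k [ik jk]] := dir i j.
  by exists k => // l kl; split; [exact: trans ik kl|exact: trans jk kl].
by move=> i _; exists i; exact: refl.
Qed.

(** On [C] the supremum is a limit along the net; limits then exist on all differences of elements
    of [C], and linearity passes to the limit. It is applied both to partial sums of functionals and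
    to evaluations at the elements of a directed set. *)
Lemma directed_functional_sup (R : realType) (W : lmodType R) (C : set W)
    (I : Type) (leI : I -> I -> Prop) (h : I -> W -> R^o) :
  (forall w, exists a b, [/\ C a, C b & w = a - b]) ->
  directed leI -> (forall i, linear (h i)) ->
  (forall w i j, C w -> leI i j -> h i w <= h j w) ->
  (forall w, C w -> exists M, forall i, h i w <= M) ->
  exists g : W -> R^o, [/\ linear g, forall w i, C w -> h i w <= g w,
    forall w e, C w -> 0 < e -> exists i, g w - e < h i w &
    forall w M, (forall i, `|h i w| <= M) -> `|g w| <= M].
Proof.
move=> Cgen dirI lh hmono hbdd.
have FF := net_tails_proper dirI; have [[i0] refl trans dir] := dirI.
set F := net_tails leI in FF.
pose S w := [set h i w | i in [set: I]].
have supS w : C w -> has_sup (S w).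
  move=> Cw; split; first by exists (h i0 w), i0.
  by have [M hM] := hbdd _ Cw; exists M => _ [i _ <-].
have le_sup w i : C w -> h i w <= sup (S w).
  by move=> Cw; apply: ub_le_sup; [case: (supS w Cw)|exists i].
have cvgC w : C w -> h ^~ w @ F --> (sup (S w) : R^o).
  move=> Cw; apply/cvgrPdist_lt => e e0.
  have [_ [i _ <-] ie] := sup_adherent e0 (supS w Cw).
  exists i => // j /= ij; rewrite ger0_norm ?subr_ge0 ?le_sup//.
  by rewrite ltrBlDr addrC -ltrBlDr (lt_le_trans ie)// hmono.
have lB i x y : h i (x - y) = h i x - h i y.
  have := lh i (-1) y x; rewrite !scaleN1r ![- y + _]addrC => ->.
  exact: addrC.
have /choice[g hg] w : exists l : R^o, h ^~ w @ F --> l.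
  have [a [b [Ca Cb ->]]] := Cgen w; exists (sup (S a) - sup (S b) : R^o).
  rewrite (_ : h^~ _ = h^~ a \- h^~ b); last by apply/funext => i; rewrite lB.
  by apply: cvgB; exact: cvgC.
have gC w : C w -> g w = sup (S w).
  by move=> Cw; apply: (cvg_unique _ (hg w) (cvgC w Cw)); exact: Rhausdorff.
exists g; split.
- move=> a x y; apply: (cvg_unique _ (hg _)); first exact: Rhausdorff.
  rewrite (_ : h^~ _ = (fun i => a *: h i x + h i y)); last first.
    by apply/funext => i; rewrite lh.
  by apply: cvgD; [apply: cvgZr; exact: hg|exact: hg].
- by move=> w i Cw; rewrite gC// le_sup.
- move=> w e Cw e0; have [_ [i _ <-] ie] := sup_adherent e0 (supS w Cw).
  by exists i; rewrite gC.
- move=> w M hM; rewrite leNgt; apply/negP => Mg.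
  have e0 : 0 < `|g w| - M by rewrite subr_gt0.
  have /cvgrPdist_lt/(_ _ e0)[i _ /(_ i (refl i))] := hg w.
  have := ler_normD (g w - h i w) (h i w).
  by rewrite subrK; have := hM i; lra.
Qed.

Definition up_directed (R : realType) (V : rieszType R) (D : set V) : Prop :=
  D !=set0 /\
  forall x y, D x -> D y -> exists z, [/\ D z, x <= z & y <= z].

Lemma directed_sig (R : realType) (V : rieszType R) (D : set V) :
  up_directed D -> directed (fun i j : {x | D x} => sval i <= sval j).
Proof.
move=> [[x0 Dx0] Ddir]; split.
- by split; exists x0.
- by move=> i; exact: lexx.
- by move=> i j k; exact: le_trans.
- move=> [x Dx] [y Dy]; have [z [Dz xz yz]] := Ddir _ _ Dx Dy.
  by exists (exist _ z Dz).
Qed.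

Section weakly_bounded.
Variables (R : realType) (V : lcsRieszType R).

(* Gliding hump: if [p (x n)] grows fast, the functional [\sum_n 2^-(n+1) f_n]
   with [f_n] norming [x n] for [p] is unbounded along [x]. *)
Lemma weakly_bounded_ge0 (D : set V) : (forall x, D x -> 0 <= x) ->
  (forall f : dual V, dual_ge0 f -> exists M, forall x, D x -> f x <= M) ->
  tvs_bounded D.
Proof.
move=> D0 Dbdd; apply/tvs_boundedP => p cp; have [sp _] := cp.
have [//|nb] := pselect (exists M, forall x, D x -> p x <= M).
(* The factor [2 ^+ n.+1] compensates the weight of [f n] in the series, so that this single term
   exceeds [n] at [x n]. *)
have /choice[x xP] n : exists x, D x /\ n%:R * 2 ^+ n.+1 < p x.
  apply: contrapT => nx; apply: nb; exists (n%:R * 2 ^+ n.+1) => x Dx.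
  by rewrite leNgt; apply/negP => xn; apply: nx; exists x.
have /choice[f fP] n : exists f : dual V,
    [/\ dual_ge0 f, forall y, `|f y| <= p y & f (x n) = p (x n)].
  by apply: exists_dual_norming => //; apply: D0; case: (xP n).
pose s n : dual V := \sum_(k < n) (2^-1 ^+ k.+1 : R) *: f k.
have sS n : s n.+1 = s n + (2^-1 ^+ n.+1 : R) *: f n by rewrite /s big_ord_recr.
have sSE n y : s n.+1 y = s n y + 2^-1 ^+ n.+1 * f n y by rewrite sS.
have h0 k : 0 <= 2^-1 ^+ k :> R by rewrite exprn_ge0// invr_ge0.
have s0 n : dual_ge0 (s n).
  elim: n => [|n ih]; first by rewrite /s big_ord0; exact: dual_ge00.
  by rewrite sS; apply: dual_ge0D => //; apply: dual_ge0Z => //; case: (fP n).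
(* The factor [1 - 2^-1 ^+ n] is the sum of the first [n] weights. *)
have sp' n y : `|s n y| <= (1 - 2^-1 ^+ n) * p y.
  elim: n => [|n ih].
    by rewrite /s big_ord0 dual0E normr0 expr0 subrr mul0r.
  rewrite sSE (le_trans (ler_normD _ _))//.
  have [_ /(_ y) fy _] := fP n.
  have : `|2^-1 ^+ n.+1 * f n y| <= 2^-1 ^+ n.+1 * p y.
    by rewrite normrM ger0_norm// ler_wpM2l.
  by rewrite !exprS; move: ih; set t := 2^-1 ^+ n; lra.
have spp n y : `|s n y| <= p y.
  rewrite (le_trans (sp' n y))//; apply: ler_piMl; first exact: seminorm_ge0.
  by have := h0 n; lra.
have smono y m n : 0 <= y -> (m <= n)%N -> s m y <= s n y.
  move=> y0 /subnK <-; elim: (n - m)%N => [//|k ih].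
  rewrite addSn sSE (le_trans ih)// lerDl mulr_ge0//.
  by have [f0 _ _] := fP (k + m)%N; exact: f0.
have [||||y y0|g [lg sg _ gM]] := @directed_functional_sup R V
    [set y | 0 <= y] nat (fun m n => (m <= n)%N) (fun n y => s n y).
- move=> y; exists (riesz_pos y), (riesz_pos (- y)).
  by rewrite /= !pos_ge0 posB.
- split=> //; [by split; exact: 0%N|by move=> i j k; exact: leq_trans|].
  by move=> i j; exists (maxn i j); rewrite leq_maxl leq_maxr.
- by move=> n; exact: dual_linear.
- by move=> y m n /smono; exact.
- by exists (p y) => n; rewrite (le_trans (ler_norm _)).
have [G Gg] : exists G : dual V, forall y, G y = g y.
  by apply: (seminorm_exists_dual cp) => // y; exact: gM.
have G0 : dual_ge0 G.
  by move=> y y0; rewrite Gg (le_trans _ (sg y 0%N y0)) ?s0.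
have [M MD] := Dbdd G G0.
have [Dx px] := xP (Num.bound `|M|).
have := MD _ Dx; rewrite leNgt => /negP; case.
set n := Num.bound _ in Dx px *.
have x0 := D0 _ Dx.
rewrite (@lt_le_trans _ _ n%:R)//.
  by rewrite (le_lt_trans (ler_norm M))// archi_boundP.
(* The partial sum of index [n.+1] is the first one containing the term of [f n]; the earlier terms
   are positive and are dropped. *)
rewrite Gg (le_trans _ (sg (x n) n.+1 x0))// sSE.
have [_ _ ->] := fP n.
rewrite -[leLHS]add0r lerD ?s0// exprVn mulrC ler_pdivlMr ?exprn_gt0//.
exact: ltW.
Qed.

(** Boundedness on each positive functional already makes [D] topologically bounded, and this gives
    strong continuity of the pointwise supremum. *)
Lemma exists_bidual_sup (D : set V) : up_directed D ->
  (forall x, D x -> 0 <= x) ->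
  (forall f : dual V, dual_ge0 f -> exists M, forall x, D x -> f x <= M) ->
  exists phi : bidual V,
    (forall x, D x -> bidual_le (bidual_embed x) phi) /\
    (forall (f : dual V) (e : R), dual_ge0 f -> 0 < e ->
      exists x, D x /\ phi f - e < f x).
Proof.
move=> dirD D0 Dbdd; have bD := weakly_bounded_ge0 D0 Dbdd.
have [||||f /Dbdd[M DM]|g [lg sg gs gM]] := @directed_functional_sup R
    (dual V) [set f | dual_ge0 f] {x | D x} (fun i j => sval i <= sval j)
    (fun i (f : dual V) => f (sval i)).
- by move=> f; have [a [b [a0 b0 ->]]] := dual_jordan f; exists a, b.
- exact: directed_sig.
- by [].
- by move=> f i j f0; exact: dual_ge0_le.
- by exists M => -[x Dx]; exact: DM.
have [phi phig] : exists phi : bidual V, forall f : dual V, phi f = g f.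
  apply: (exists_bidual lg bD) => f e e0 fD; apply: gM => -[x Dx]; exact: fD.
exists phi; split=> [x Dx f f0|f e f0 e0].
  by rewrite phig; exact: (sg f (exist _ x Dx) f0).
by have [[x Dx] xe] := gs f e f0 e0; exists x; rewrite phig.
Qed.

End weakly_bounded.

Definition down_directed (R : realType) (V : rieszType R) (D : set V) : Prop :=
  D !=set0 /\
  forall x y, D x -> D y -> exists z, [/\ D z, z <= x & z <= y].

(** Common ground of both directions: it holds in Dedekind complete spaces with the Lebesgue
    property and in KR-spaces. The last clause says that positive functionals attain the supremum in
    the limit. *)
Definition monotone_complete (R : realType) (V : lcsRieszType R) : Prop :=
  forall D : set V, up_directed D -> (exists u, forall x, D x -> x <= u) ->
  exists s, [/\ forall x, D x -> x <= s,
    forall u, (forall x, D x -> x <= u) -> s <= u &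
    forall (f : dual V) (e : R), dual_ge0 f -> 0 < e ->
      exists x, D x /\ f s - e < f x].

(** * Monotone completeness *)

Section monotone_complete.
Variables (R : realType) (V : lcsRieszType R).

Lemma dual_net_cvg (I : Type) (leI : I -> I -> Prop) (x : I -> V) (l : V)
    (f : dual V) (e : R) : x @ net_tails leI --> l -> 0 < e ->
  exists i, forall j, leI i j -> `|f l - f (x j)| < e.
Proof.
move=> xl e0; have /cvgrPdist_lt/(_ e e0) := @dual_continuous _ _ f l.
by move=> /xl[i _ ie]; exists i.
Qed.

Lemma increasing_net_lim (I : Type) (leI : I -> I -> Prop) (x : I -> V)
    (l : V) :
  directed leI -> (forall i j, leI i j -> x i <= x j) ->
  x @ net_tails leI --> l ->
  [/\ forall i, x i <= l, forall u, (forall i, x i <= u) -> l <= u &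
    forall (f : dual V) (e : R), dual_ge0 f -> 0 < e ->
      exists i, f l - e < f (x i)].
Proof.
move=> [_ refl _ dir] xmono xl; split.
- move=> i; apply: dual_sep_le => f f0; apply/ler_addgt0Pr => e e0.
  have [j je] := dual_net_cvg f xl e0; have [k [ik jk]] := dir i j.
  have := je k jk; rewrite ltr_norml => /andP[+ _].
  by have := dual_ge0_le f0 (xmono _ _ ik); lra.
- move=> u xu; apply: dual_sep_le => f f0; apply/ler_addgt0Pr => e e0.
  have [j /(_ j (refl j))] := dual_net_cvg f xl e0.
  rewrite ltr_norml => /andP[_].
  by have := dual_ge0_le f0 (xu j); lra.
- move=> f e f0 e0; have [i /(_ i (refl i))] := dual_net_cvg f xl e0.
  by rewrite ltr_norml => /andP[_ h]; exists i; move: h; lra.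
Qed.

Lemma order_bounded_tvs_bounded (A : set V) (u : V) :
  (forall x, A x -> 0 <= x /\ x <= u) -> tvs_bounded A.
Proof.
move=> Au; apply/tvs_boundedP => p [sp _]; exists (p u) => x /Au[x0 xu].
exact: seminorm_le.
Qed.

Lemma dedekind_lebesgue_monotone_complete :
  dedekind_complete V -> lebesgue_property V -> monotone_complete V.
Proof.
move=> hD hL D dirD [u Du]; have [D0 _] := dirD.
have [s [sD sleast]] : supremums D !=set0.
  by apply: hD; split=> //; exists u.
exists s; split=> // f e f0 e0.
(* The differences [s - x] decrease to 0, so the Lebesgue property applies to them. *)
have cvg0 := hL _ _ (fun i : {x | D x} => s - sval i) (directed_sig dirD).
have [||i /(_ i (lexx _))] := dual_net_cvg f (cvg0 _ _) e0.
- by move=> i j ij; rewrite rlerD2l rlerN2.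
- split=> [_ [[x Dx] _ <-]|b bD] /=; first by rewrite rsubr_ge0; exact: sD.
  rewrite -(rlerD2l s) addr0 -rlerBrDr; apply: sleast => x Dx.
  rewrite rlerBrDr -rlerBrDl; apply: bD; by exists (exist _ x Dx).
- rewrite dual_apply0 sub0r normrN dual_sub => h; exists (sval i).
  split; first exact: (svalP i).
  by have := ler_norm (f s - f (sval i)); lra.
Qed.

Lemma KR_monotone_complete : KR_space V -> monotone_complete V.
Proof.
move=> hK D dirD [u Du]; have [[d0 Dd0] Ddir] := dirD.
have dirI := directed_sig dirD.
(* The KR property concerns positive nets: joining with a fixed [d0] and translating makes [D]
   positive. *)
pose x (i : {x | D x}) := (sval i \v d0) - d0.
have x0 i : 0 <= x i by rewrite rsubr_ge0 join_ubr.
have xmono i j : sval i <= sval j -> x i <= x j.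
  by move=> ij; rewrite rlerD2r; exact: join_le.
have [|l xl] := hK _ _ x dirI x0 xmono.
  apply: (@order_bounded_tvs_bounded _ (u - d0)) => _ [[y Dy] _ <-].
  by split; rewrite // rlerD2r; apply: join_lub; exact: Du.
have [l1 l2 l3] := increasing_net_lim dirI xmono xl.
exists (l + d0); split.
- move=> y Dy; rewrite -rlerBlDr (le_trans _ (l1 (exist _ y Dy)))//.
  by rewrite rlerD2r join_ubl.
- move=> w Dw; rewrite -rlerBrDr; apply: l2 => -[y Dy] /=.
  by rewrite rlerD2r; apply: join_lub; exact: Dw.
- move=> f e f0 e0; have [[y Dy]] := l3 f e f0 e0.
  (* An element of [D] above both [y] and [d0] is above their join, which need not belong to [D]. *)
  have [z [Dz yz d0z]] := Ddir _ _ Dy Dd0.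
  move=> h; exists z; split=> //.
  have := dual_ge0_le f0 (join_lub yz d0z).
  by move: h; rewrite /x /= dual_sub dual_add; lra.
Qed.

Lemma monotone_complete_inf (D : set V) : monotone_complete V ->
  down_directed D -> (exists u, forall x, D x -> u <= x) ->
  exists s, [/\ forall x, D x -> s <= x,
    forall u, (forall x, D x -> u <= x) -> u <= s &
    forall (f : dual V) (e : R), dual_ge0 f -> 0 < e ->
      exists x, D x /\ f x < f s + e].
Proof.
move=> mV [[d Dd] Ddir] [u Du].
have [||s [s1 s2 s3]] := mV [set x | D (- x)].
- split; first by exists (- d); rewrite /= opprK.
  move=> x y /= Dx Dy; have [z [Dz zx zy]] := Ddir _ _ Dx Dy.
  by exists (- z); rewrite opprK !(rlerNr _ z).
- by exists (- u) => x /Du; rewrite rlerNr.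
exists (- s); split.
- by move=> x Dx; rewrite rlerNl; apply: s1; rewrite /= opprK.
- by move=> w Dw; rewrite rlerNr; apply: s2 => x /Dw; rewrite rlerNr.
- move=> f e f0 e0; have [x [Dx xe]] := s3 f e f0 e0; exists (- x); split=> //.
  by rewrite !dual_opp; move: xe; lra.
Qed.

End monotone_complete.

(** * Weak compactness of order intervals *)

(** Closing under finite joins makes a nonempty set upward directed without changing its upper
    bounds. *)
Inductive join_closure (R : realType) (V : rieszType R) (A : set V) :
    V -> Prop :=
| join_closure_base x : A x -> join_closure A x
| join_closure_join x y :
    join_closure A x -> join_closure A y -> join_closure A (x \v y).

Section order_intervals.
Variables (R : realType) (V : lcsRieszType R).
Hypothesis mV : monotone_complete V.
Implicit Types (f g : dual V) (x y z : V).

Definition order_interval (a b : V) : set V := [set x | a <= x /\ x <= b].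

Lemma monotone_complete_sup (A : set V) : A !=set0 ->
  (exists u, forall x, A x -> x <= u) ->
  exists s, (forall x, A x -> x <= s) /\
    (forall u, (forall x, A x -> x <= u) -> s <= u).
Proof.
move=> [a Aa] [u Au].
have ubJ w : (forall x, A x -> x <= w) -> forall x, join_closure A x -> x <= w.
  by move=> Aw x; elim=> [y /Aw//|y y' _ yw _ y'w]; exact: join_lub.
have [||s [s1 s2 _]] := mV (D := join_closure A).
- split; first by exists a; exact: join_closure_base.
  move=> x y Jx Jy; exists (x \v y); split; last exact: join_ubr.
    exact: join_closure_join.
  exact: join_ubl.
- by exists u; exact: ubJ.
exists s; split=> [x Ax|w Aw]; first by apply/s1/join_closure_base.
by apply: s2; exact: ubJ.
Qed.

(* [Q x], the supremum of [2 t x - t ^ 2 z] over [t], plays the role of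
   [x ^ 2 / z]. *)
Lemma exists_quad z : 0 <= z -> exists Q : V -> V, forall x,
  order_interval 0 z x ->
  [/\ 0 <= Q x, Q x <= z, forall t : R, (2 * t) *: x - (t ^+ 2) *: z <= Q x &
    forall u, (forall t : R, (2 * t) *: x - (t ^+ 2) *: z <= u) -> Q x <= u].
Proof.
move=> z0; suff /choice[Q hQ] x : exists y, order_interval 0 z x ->
  [/\ 0 <= y, y <= z, forall t : R, (2 * t) *: x - (t ^+ 2) *: z <= y &
  forall u, (forall t : R, (2 * t) *: x - (t ^+ 2) *: z <= u) -> y <= u].
  by exists Q.
have [[x0 xz]|nx] := pselect (order_interval 0 z x); last by exists 0.
(* For [t >= 0] the difference of the two sides is [(t - 1) ^ 2 z + 2 t (z - x)]; for [t < 0] the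
   left side is negative or zero. *)
have ubz (t : R) : (2 * t) *: x - (t ^+ 2) *: z <= z.
  apply: dual_sep_le => f f0; rewrite dual_sub !dual_scale.
  have fx0 := f0 _ x0; have fz0 := f0 _ z0; have fxz := dual_ge0_le f0 xz.
  have := mulr_ge0 fz0 (sqr_ge0 (t - 1)); have [t0|t0] := leP 0 t.
    have : 0 <= t * (f z - f x) by rewrite mulr_ge0// subr_ge0.
    by rewrite expr2; nra.
  by have := mulr_ge0_le0 fx0 (ltW t0); have := mulr_ge0 fz0 (sqr_ge0 t); nra.
have [||s [s1 s2]] := @monotone_complete_sup
  [set (2 * t) *: x - (t ^+ 2) *: z | t in [set: R]].
- by exists ((2 * 0) *: x - (0 ^+ 2) *: z), 0.
- by exists z => _ [t _ <-].
have s1' (t : R) : (2 * t) *: x - (t ^+ 2) *: z <= s by apply: s1; exists t.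
exists s => _; split=> //.
- by have := s1' 0; rewrite mulr0 expr0n/= !scale0r subr0.
- by apply: s2 => _ [t _ <-].
- by move=> u hu; apply: s2 => _ [t _ <-].
Qed.

Definition midpoint x y : V := (2^-1 : R) *: (x + y).

Lemma midpoint_interval a b x y : order_interval a b x ->
  order_interval a b y -> order_interval a b (midpoint x y).
Proof.
move=> [ax xb] [ay yb]; split; apply: dual_sep_le => f f0;
  rewrite dual_scale dual_add.
  by have := dual_ge0_le f0 ax; have := dual_ge0_le f0 ay; lra.
by have := dual_ge0_le f0 xb; have := dual_ge0_le f0 yb; lra.
Qed.

(** Averaging the lower bounds of [Q x] at parameter [s + e] and of [Q y] at [s - e] gives the
    expression defining [Q] at the midpoint, plus [e (x - y) - e ^ 2 z]. Taking the supremum over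
    [s], then [e = d] and [e = - d], produces the absolute value. *)
Lemma quad_uniformly_convex z (Q : V -> V) f (d : R) x y :
  (forall x, order_interval 0 z x ->
    [/\ 0 <= Q x, Q x <= z, forall t : R, (2 * t) *: x - (t ^+ 2) *: z <= Q x &
    forall u, (forall t : R, (2 * t) *: x - (t ^+ 2) *: z <= u) -> Q x <= u]) ->
  order_interval 0 z x -> order_interval 0 z y -> dual_ge0 f -> 0 < d ->
  2 * d * f (riesz_abs (x - y)) <=
    f (Q x) + f (Q y) - 2 * f (Q (midpoint x y)) + 2 * d ^+ 2 * f z.
Proof.
move=> hQ xz yz f0 d0; have [_ _ Qx _] := hQ x xz; have [_ _ Qy _] := hQ y yz.
have [_ _ _ Qm] := hQ _ (midpoint_interval xz yz).
have key (e : R) : (2 * e) *: (x - y) <=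
    Q x + Q y - 2 *: Q (midpoint x y) + (2 * e ^+ 2) *: z.
  pose c := 2^-1 *: (Q x + Q y + (2 * e ^+ 2) *: z - (2 * e) *: (x - y)).
  have : Q (midpoint x y) <= c.
    apply: Qm => s; apply: dual_sep_le => g g0.
    have := dual_ge0_le g0 (Qx (s + e)); have := dual_ge0_le g0 (Qy (s - e)).
    rewrite /c /midpoint !(dual_sub, dual_add, dual_scale).
    nra.
  move=> Qc; apply: dual_sep_le => g g0; have := dual_ge0_le g0 Qc.
  by rewrite /c !(dual_sub, dual_add, dual_scale); nra.
have : riesz_abs ((2 * d) *: (x - y)) <=
    Q x + Q y - 2 *: Q (midpoint x y) + (2 * d ^+ 2) *: z.
  apply: abs_lub; first exact: key.
  by have := key (- d); rewrite sqrrN mulrN scaleNr.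
rewrite absZ gtr0_norm ?mulr_gt0// => /(dual_ge0_le f0).
by rewrite !(dual_sub, dual_add, dual_scale).
Qed.

Lemma seminorm_dual_abs f : dual_ge0 f ->
  riesz_seminorm (fun x => f (riesz_abs x)).
Proof.
move=> f0; split=> [x y|a x|x y xy]; last exact: dual_ge0_le.
  by rewrite -dual_add; exact/dual_ge0_le/abs_subadd.
by rewrite absZ dual_scale.
Qed.

(* [G] is generated by the near-minimizers of the uniformly convex function
   [f \o Q] over the convex sets of [F]. *)
Lemma convex_refinement z f (F : set_system V) : 0 <= z -> dual_ge0 f ->
  ProperFilter F -> F (order_interval 0 z) ->
  exists G : set_system V, [/\ ProperFilter G, G (order_interval 0 z),
    forall K, F K -> (forall x y, K x -> K y -> K (midpoint x y)) -> G K &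
    forall e : R, 0 < e -> exists A, G A /\
      forall x y, A x -> A y -> f (riesz_abs (x - y)) < e].
Proof.
move=> z0 f0 FF Fz; have [Q hQ] := exists_quad z0.
pose mid (K : set V) := forall x y, K x -> K y -> K (midpoint x y).
pose C : set (set V) := [set K | [/\ F K, K `<=` order_interval 0 z & mid K]].
have Cz : C (order_interval 0 z).
  by split=> // x y; exact: midpoint_interval.
have CI K L : C K -> C L -> C (K `&` L).
  move=> [FK Kz mK] [FL Lz mL]; split; first exact: filterI.
    by move=> x [Kx _]; exact: Kz.
  by move=> x y [Kx Lx] [Ky Ly]; split; [exact: mK|exact: mL].
pose q x : R := f (Q x).
have q0 x : order_interval 0 z x -> 0 <= q x by move=> /hQ[Q0 _ _ _]; exact: f0.
have qz x : order_interval 0 z x -> q x <= f z.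
  by move=> /hQ[_ Qz _ _]; exact: dual_ge0_le.
have CN0 K : C K -> K !=set0 by move=> [FK _ _]; exact: filter_ex FK.
have infK K : C K -> has_inf [set q x | x in K].
  move=> CK; have [x Kx] := CN0 K CK; split; first by exists (q x), x.
  by case: CK => _ Kz _; exists 0 => _ [y /Kz yz <-]; exact: q0.
pose S := [set inf [set q x | x in K] | K in C].
have supS : has_sup S.
  split; first by exists (inf [set q x | x in order_interval 0 z]),
    (order_interval 0 z).
  exists (f z) => _ [K CK <-]; have [x Kx] := CN0 K CK.
  rewrite (@le_trans _ _ (q x))//; last first.
    by apply: qz; case: CK => _ Kz _; exact: Kz.
  by apply: ge_inf; [case: (infK K CK)|exists x].
(* The maximin value of [q]: sets of [C] have elements with [q] barely above [m], and some sets of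
   [C] have none with [q] much below it. *)
pose m := sup S.
have lowK (e : R) : 0 < e -> exists2 K, C K & forall x, K x -> m - e < q x.
  move=> e0; have [_ [K CK <-] Ke] := sup_adherent e0 supS.
  exists K => // x Kx; apply: (lt_le_trans Ke).
  by apply: ge_inf; [case: (infK K CK)|exists x].
have nearK K (e : R) : C K -> 0 < e -> exists2 x, K x & q x < m + e.
  move=> CK e0; have [_ [x Kx <-] xe] := inf_adherent e0 (infK K CK).
  exists x => //; apply: (lt_le_trans xe); rewrite lerD2r.
  by apply: ub_le_sup; [case: supS|exists K].
pose B (k : set V * R) := [set x | k.1 x /\ q x < m + k.2].
pose G := filter_from [set k : set V * R | C k.1 /\ 0 < k.2] B.
have GF : ProperFilter G.
  apply: filter_from_proper; last first.
    by move=> [K e] [CK e0]; have [x Kx xe] := nearK K e CK e0; exists x.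
  apply: filter_from_filter.
    by exists (order_interval 0 z, 1); split; rewrite //= ltr01.
  move=> [K d] [L e] /= [CK d0] [CL e0].
  exists (K `&` L, Num.min d e).
    by split; [exact: CI|rewrite /= lt_min d0].
  move=> x [[Kx Lx]] /= xde; split; split=> //=; apply: (lt_le_trans xde).
    by rewrite lerD2l ge_min lexx.
  by rewrite lerD2l ge_min lexx orbT.
have GC K : C K -> G K.
  by move=> CK; exists (K, 1); [split; rewrite //= ltr01|move=> x []].
exists G; split=> //; first exact: GC.
- move=> K FK mK; have : G (order_interval 0 z `&` K).
    apply: GC; split; first exact: filterI.
      by move=> x [].
    by move=> x y [xz Kx] [yz Ky]; split; [exact: midpoint_interval|exact: mK].
  by apply: filterS => x [].
- move=> e e0; have fz0 := f0 _ z0.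
  (* With tolerance [d * e / 8] the convexity defect is below [d * e / 2], and this [d] keeps
     [2 * d ^+ 2 * f z] at most [d * e]; the total stays below [2 * d * e]. Adding 1 covers
     [f z = 0]. *)
  pose d := e / (2 * (f z + 1)).
  have d0 : 0 < d by rewrite divr_gt0// mulr_gt0//; lra.
  have [K CK Kq] := lowK (d * e / 8) ltac:(rewrite divr_gt0// mulr_gt0//).
  exists (B (K, d * e / 8)); split.
    by exists (K, d * e / 8) => //; split=> //=; rewrite divr_gt0// mulr_gt0.
  move=> x y [/= Kx qx] [/= Ky qy]; have [_ Kz mK] := CK.
  have := quad_uniformly_convex hQ (Kz _ Kx) (Kz _ Ky) f0 d0.
  have := Kq _ (mK _ _ Kx Ky).
  have ed : d * (2 * (f z + 1)) = e.
    by rewrite /d divfK// mulf_neq0// gt_eqF//; lra.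
  rewrite -/(q x) -/(q y) -/(q (midpoint x y)) => qm hxy.
  rewrite -(ltr_pM2l d0).
  have : d * (d * (f z + 1)) * 2 = d * e by rewrite -ed; lra.
  have : 0 < d * e by rewrite mulr_gt0.
  have : 0 < d * d by rewrite mulr_gt0.
  by move: hxy qm qx qy; rewrite expr2; nra.
Qed.

End order_intervals.

Lemma half_expn_gt0 (R : realType) n : 0 < 2^-1 ^+ n :> R.
Proof. by rewrite exprn_gt0// invr_gt0. Qed.

Lemma half_expn_lt (R : realType) (e : R) : 0 < e ->
  exists N, forall n, (N <= n)%N -> 2^-1 ^+ n < e.
Proof.
move=> e0; have h : `|2^-1 : R| < 1.
  by rewrite gtr0_norm ?invr_gt0// invf_lt1// ltr1n.
have /cvgrPdist_lt/(_ _ e0)[N _ NP] := cvg_expr h.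
by exists N => n /NP /=; rewrite sub0r normrN gtr0_norm ?half_expn_gt0.
Qed.

(** * Completeness of order intervals for one functional *)

Section order_intervals.
Variables (R : realType) (V : lcsRieszType R).
Hypothesis mV : monotone_complete V.
Implicit Types (f g : dual V) (x y z : V).

Fixpoint join_run (x : nat -> V) (n k : nat) : V :=
  if k is k'.+1 then join_run x n k' \v x (n + k)%N else x n.

Lemma join_run_ub (x : nat -> V) n k : x (n + k)%N <= join_run x n k.
Proof. by case: k => [|k]; rewrite ?addn0//=; exact: join_ubr. Qed.

Lemma join_run_lub (x : nat -> V) n k u : (forall j, (n <= j)%N -> x j <= u) ->
  join_run x n k <= u.
Proof.
move=> xu; elim: k => [|k ih] /=; first exact: xu.
by apply: join_lub => //; apply: xu; rewrite leq_addr.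
Qed.

Lemma join_run_mono (x : nat -> V) n k l : (k <= l)%N ->
  join_run x n k <= join_run x n l.
Proof.
move=> /subnK <-; elim: (l - k)%N => [//|j ih].
by rewrite addSn (le_trans ih)//=; exact: join_ubl.
Qed.

(** The limit is the upper limit of the sequence: the infimum over [n] of [u n], the supremum of the
    [x j] with [j >= n]. The geometric rate makes [f (u n)] exceed [f (x n)] by at most
    [2 * 2^-1 ^+ n]. *)
Lemma cauchy_seq_lim z f (x : nat -> V) : dual_ge0 f ->
  (forall n, order_interval 0 z (x n)) ->
  (forall n j, (n <= j)%N ->
    f (riesz_abs (x n - x j)) <= 2^-1 ^+ n) ->
  exists v, order_interval 0 z v /\
    forall e : R, 0 < e -> exists N, forall n, (N <= n)%N ->
      f (riesz_abs (x n - v)) < e.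
Proof.
move=> f0 xz xc.
have /choice[u hu] n : exists u, [/\ forall k, join_run x n k <= u,
    forall w, (forall k, join_run x n k <= w) -> u <= w &
    f u <= f (x n) + 2 * 2^-1 ^+ n].
  have [||u [u1 u2 u3]] := mV (D := range (join_run x n)).
  - split; first by exists (x n), 0%N.
    move=> _ _ [k _ <-] [l _ <-]; exists (join_run x n (maxn k l)).
    by split; [exists (maxn k l)|exact/join_run_mono/leq_maxl|
      exact/join_run_mono/leq_maxr].
  - exists z => _ [k _ <-]; apply: join_run_lub => j _; by case: (xz j).
  exists u; split=> [k|w hw|].
  - by apply: u1; exists k.
  - by apply: u2 => _ [k _ <-].
  (* Joining the next term raises [f] by at most [2^-1 ^+ (n + k)], and the bound is the sum of
     these increments. *)
  have step k : f (join_run x n k) <=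
      f (x n) + 2 * 2^-1 ^+ n - 2 * 2^-1 ^+ (n + k).
    elim: k => [|k ih]; first by rewrite addn0 addrK.
    have -> : f (join_run x n k.+1) = f (join_run x n k) +
        f (riesz_pos (x (n + k.+1)%N - join_run x n k)).
      by rewrite /= riesz_joinC join_pos dual_add addrC.
    have : f (riesz_pos (x (n + k.+1)%N - join_run x n k)) <= 2^-1 ^+ (n + k).
      rewrite (le_trans _ (xc (n + k)%N (n + k.+1)%N _)) ?leq_add2l//.
      rewrite dual_ge0_le// -absN opprB (le_trans _ (pos_le_abs _))//.
      by apply: pos_le; rewrite rlerD2l rlerN2 join_run_ub.
    by rewrite addnS exprS; move: ih; lra.
  apply/ler_addgt0Pr => e e0; have [_ [[k _ <-] ke]] := u3 f e f0 e0.
  have := step k; have := half_expn_gt0 R (n + k).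
  by move: ke; lra.
have xu n j : (n <= j)%N -> x j <= u n.
  move=> nj; have [u1 _ _] := hu n.
  by rewrite (le_trans _ (u1 (j - n)%N))// -{1}(subnKC nj) join_run_ub.
have uz n : u n <= z.
  have [_ u2 _] := hu n; apply: u2 => k; apply: join_run_lub => j _.
  by case: (xz j).
have u_anti m n : (m <= n)%N -> u n <= u m.
  move=> mn; have [_ u2 _] := hu n; apply: u2 => k; apply: join_run_lub => j nj.
  by apply: xu; exact: leq_trans nj.
have u0 n : 0 <= u n.
  by rewrite (le_trans _ (xu n n (leqnn n)))//; case: (xz n).
have [||v [v1 v2 v3]] := monotone_complete_inf (D := range u) mV.
- split; first by exists (u 0%N), 0%N.
  move=> _ _ [m _ <-] [n _ <-]; exists (u (maxn m n)).
  by split; [exists (maxn m n)|exact/u_anti/leq_maxl|exact/u_anti/leq_maxr].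
- by exists 0 => _ [n _ <-].
have vu n : v <= u n by apply: v1; exists n.
exists v; split.
  by split; [apply: v2 => _ [n _ <-]|exact: le_trans (vu 0%N) (uz 0%N)].
move=> e e0; have e20 : 0 < e / 2 by rewrite divr_gt0.
have [_ [[N _ <-] Ne]] := v3 f (e / 2) f0 e20.
have e40 : 0 < e / 4 by rewrite divr_gt0.
have [M Mlt] := half_expn_lt e40.
exists (maxn N M) => n; rewrite geq_max => /andP[Nn Mn].
have [_ _ un] := hu n.
(* Both [x n] and [v] lie below [u n], so their distance is measured through [u n]. *)
have h1 : f (riesz_abs (x n - v)) <= f (u n - x n) + f (u n - v).
  rewrite -dual_add dual_ge0_le// (_ : x n - v = - (u n - x n) + (u n - v)).
    apply: le_trans (abs_subadd _ _) _; rewrite absN !ge0_abs// rsubr_ge0//.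
    exact: xu.
  by rewrite opprB addrA subrK.
have h2 := dual_ge0_le f0 (u_anti _ _ Nn).
by have := Mlt n Mn; move: h1 un h2 Ne; rewrite !dual_sub; lra.
Qed.

(** Only the seminorm [f (riesz_abs _)] is involved, so a sequence picked in smaller and smaller
    sets of the filter determines the limit. *)
Lemma cauchy_filter_lim z f (G : set_system V) : dual_ge0 f ->
  ProperFilter G -> G (order_interval 0 z) ->
  (forall e : R, 0 < e -> exists A, G A /\
      forall x y, A x -> A y -> f (riesz_abs (x - y)) < e) ->
  exists v, order_interval 0 z v /\
    forall e : R, 0 < e -> G [set y | f (riesz_abs (y - v)) < e].
Proof.
move=> f0 GF Gz Gc.
have /choice[A hA] n := Gc _ (half_expn_gt0 R n).
(* Intersecting the first sets puts [x n] and all later terms in the same [A n]. *)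
pose B n := [set x | forall k, (k <= n)%N -> A k x].
have GB n : G (B n).
  elim: n => [|n ih].
    have [GA _] := hA 0%N; apply: filterS GA => x Ax k.
    by rewrite leqn0 => /eqP ->.
  have [GA _] := hA n.+1; apply: filterS2 ih GA => x Bx Ax k.
  by rewrite leq_eqVlt => /predU1P[->//|]; rewrite ltnS; exact: Bx.
have /choice[x hx] n : exists x, B n x /\ order_interval 0 z x.
  by have [x [? ?]] := filter_ex (filterI (GB n) Gz); exists x.
have [n|n j nj|v [vz vlim]] := @cauchy_seq_lim z f x f0.
- by case: (hx n).
- have [_ hAn] := hA n; apply/ltW/hAn; first by case: (hx n) => + _; exact.
  by case: (hx j) => + _; exact.
exists v; split=> // e e0; have e20 : 0 < e / 2 by rewrite divr_gt0.
have [N hN] := vlim _ e20; have [A' [GA' hA']] := Gc _ e20.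
have [M Mlt] := half_expn_lt e20.
set n := maxn N M.
apply: filterS (GB n) => y By /=; have [_ hAn] := hA n.
have [Bxn _] := hx n.
have h1 := hAn _ _ (By n (leqnn n)) (Bxn n (leqnn n)).
have h2 := hN n (leq_maxl _ _); have h3 := Mlt n (leq_maxr _ _).
have [sD _ _] := seminorm_dual_abs f0.
have := sD (y - x n) (x n - v); rewrite addrA subrK.
by move: h1 h2 h3; lra.
Qed.

End order_intervals.

Section weak_compactness.
Variables (R : realType) (V : lcsRieszType R).
Hypothesis mV : monotone_complete V.
Implicit Types (f g : dual V) (x y z : V).

(* A Radon-Nikodym theorem, [f] playing the role of the reference measure. *)
Lemma weak_limit_dominated z f (F : set_system V) (phi : dual V -> R) :
  0 <= z -> dual_ge0 f -> ProperFilter F -> F (order_interval 0 z) ->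
  (forall g, (fun x => g x : R^o) @ F --> (phi g : R^o)) ->
  exists v, order_interval 0 z v /\
    forall g, dual_ge0 g -> dual_ge0 (f - g) -> g v = phi g.
Proof.
move=> z0 f0 FF Fz Fphi.
have [G [GF Gz GC Gc]] := convex_refinement mV z0 f0 FF Fz.
have [v [vz vlim]] := cauchy_filter_lim mV f0 GF Gz Gc.
exists v; split=> // g g0 fg0; apply/eqP; rewrite eq_sym -subr_eq0 -normr_le0.
apply/ler_addgt0Pr => e e0; rewrite add0r.
have e20 : 0 < e / 2 by rewrite divr_gt0.
(* Only midpoint-convex sets of [F] are known to belong to [G]; this one is such, [g] being
   linear. *)
have GB : G [set y | `|phi g - g y| < e / 2].
  apply: GC; first by have /cvgrPdist_lt/(_ _ e20) := Fphi g.
  move=> x y /= xe ye; rewrite /midpoint dual_scale dual_add.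
  rewrite (_ : _ - _ = 2^-1 * ((phi g - g x) + (phi g - g y))); last by lra.
  rewrite normrM gtr0_norm ?invr_gt0//.
  by have := ler_normD (phi g - g x) (phi g - g y); move: xe ye; lra.
have [y [/= ye /= yv]] := filter_ex (filterI GB (vlim _ e20)).
have : `|g (y - v)| <= f (riesz_abs (y - v)).
  rewrite (le_trans (dual_norm_le_abs _ g0))//.
  by have := fg0 _ (abs_ge0 (y - v)); rewrite dualBE subr_ge0.
have := ler_normD (phi g - g y) (g (y - v)); rewrite {1}dual_sub addrA subrK.
by move: ye yv; lra.
Qed.

(* The representing elements [v] become monotone in [f] once the smallest one
   is chosen for each [f]; their supremum represents [phi] everywhere. *)
Lemma weak_limit_interval z (F : set_system V) (phi : dual V -> R) :
  0 <= z -> ProperFilter F -> F (order_interval 0 z) ->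
  (forall g, (fun x => g x : R^o) @ F --> (phi g : R^o)) ->
  exists v, order_interval 0 z v /\ forall g, g v = phi g.
Proof.
move=> z0 FF Fz Fphi.
pose M f := [set v | order_interval 0 z v /\
  forall g, dual_ge0 g -> dual_ge0 (f - g) -> g v = phi g].
have M_anti f f' : dual_ge0 (f' - f) -> M f' `<=` M f.
  move=> ff' v [vz hv]; split=> // g g0 fg0; apply: hv => //.
  have -> : f' - g = (f' - f) + (f - g) by rewrite addrA subrK.
  exact: dual_ge0D.
have MI f x y : dual_ge0 f -> M f x -> M f y -> M f (x \^ y).
  move=> f0 [[x0 xz] hx] [[y0 yz] hy]; split.
    by split; [exact: meet_glb|exact: le_trans (meet_lbl _ _) xz].
  (* This value is [g (x - y)] for some [g] between 0 and [f], where [x] and [y] both represent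
     [phi]. Passing to the meet therefore changes no value on such functionals. *)
  have fxy : f (riesz_pos (x - y)) = 0.
    have [g [g0 fg0 <-]] := exists_dual_split (x - y) f0.
    by rewrite dual_sub hx// hy// subrr.
  move=> g g0 fg0; rewrite meet_pos dual_sub hx//.
  rewrite (_ : g (riesz_pos _) = 0) ?subr0//.
  apply/eqP; rewrite eq_le g0 ?pos_ge0// andbT -fxy.
  by have := fg0 _ (pos_ge0 (x - y)); rewrite dualBE subr_ge0.
have /choice[m hm] f : exists v, dual_ge0 f -> M f v /\
    (forall x, M f x -> v <= x).
  have [f0|nf0] := pselect (dual_ge0 f); last by exists 0.
  have [w [wz hw]] := weak_limit_dominated z0 f0 FF Fz Fphi.
  have Mw : M f w by [].
  have [||s [s1 s2 s3]] := monotone_complete_inf (D := M f) mV.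
  - split; first by exists w.
    move=> x y Mx My; exists (x \^ y).
    by split; [exact: MI|exact: meet_lbl|exact: meet_lbr].
  - by exists 0 => x [[]].
  exists s => _; split=> //; split.
    split; first by apply: s2 => x [[]].
    by apply: le_trans (s1 w Mw) _; case: wz.
  move=> g g0 fg0; apply/eqP; rewrite eq_le; apply/andP; split.
    by case: (Mw) => _ <-//; exact: dual_ge0_le (s1 w Mw).
  apply/ler_addgt0Pr => e e0; have [x [Mx xe]] := s3 g e g0 e0.
  by case: Mx => _ <-//; exact: ltW.
have [||v [v1 v2 v3]] := mV (D := [set m f | f in [set f | dual_ge0 f]]).
- split; first by exists (m 0), 0 => //; exact: dual_ge00.
  move=> _ _ [f f0 <-] [g g0 <-]; exists (m (f + g)).
  have fg0 := dual_ge0D f0 g0.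
  have [Mfg _] := hm _ fg0.
  split; first by exists (f + g).
  - have [_] := hm f f0; apply; apply: M_anti Mfg.
    by rewrite addrAC subrr add0r.
  - by have [_] := hm g g0; apply; apply: M_anti Mfg; rewrite addrK.
- by exists z => _ [f f0 <-]; have [[[]]] := hm f f0.
have vphi g : dual_ge0 g -> g v = phi g.
  move=> g0; apply/eqP; rewrite eq_le; apply/andP; split.
    (* Each [m f] lies below [m (f + g)], whose value at [g] is exactly [phi g]; conversely [m g]
       lies below [v]. *)
    apply/ler_addgt0Pr => e e0; have [_ [[f f0 <-] fe]] := v3 g e g0 e0.
    have fg0 := dual_ge0D f0 g0; have [[_ hfg] _] := hm _ fg0.
    have fg0' : dual_ge0 (f + g - g) by rewrite addrK.
    have := hfg g g0 fg0'.
    have : m f <= m (f + g).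
      have [_] := hm f f0; apply; apply: M_anti (hm _ fg0).1.
      by rewrite addrAC subrr add0r.
    by move=> /(dual_ge0_le g0); move: fe; lra.
  have [[_ hg] _] := hm g g0.
  rewrite -hg//; first by apply: dual_ge0_le => //; apply: v1; exists g.
  by rewrite subrr; exact: dual_ge00.
exists v; split.
  split; last by apply: v2 => _ [f f0 <-]; have [[[]]] := hm f f0.
  have [[[m0 _] _] _] := hm 0 (@dual_ge00 _ V).
  by rewrite (le_trans m0)//; apply: v1; exists 0 => //; exact: dual_ge00.
have phiB (g h : dual V) : phi (g - h) = phi g - phi h.
  apply: (cvg_unique _ (Fphi _)); first exact: Rhausdorff.
  rewrite (_ : (fun x => _) = (fun x => g x : R^o) \- (fun x => h x : R^o)).
    exact: cvgB (Fphi g) (Fphi h).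
  by apply/funext.
move=> g; have [g1 [g2 [g10 g20 ->]]] := dual_jordan g.
by rewrite phiB dualBE !vphi.
Qed.

End weak_compactness.

(** * Factoring through a KR-space *)

Lemma fmap_ultra (T U : Type) (f : T -> U) (F : set_system T) :
  UltraFilter F -> UltraFilter (f @ F).
Proof.
move=> FU; split; first exact: fmap_proper_filter.
move=> G GG FG; apply/seteqP; split=> // A GA.
have [//|FnA] := in_ultra_setVsetC (f @^-1` A) FU.
have : G (A `&` ~` A) by apply: filterI => //; exact: FG.
by rewrite setICr => /filter_not_empty.
Qed.

(** * The weak topology *)

Section weak_topology.
Variables (R : realType) (X : preTopologicalLmodType R).

Lemma weak_cvgP (F : set_system X) (x : X) : Filter F ->
  (F --> (x : weak_space X)) <->
  forall f : dual X, (fun y => f y : R^o) @ F --> (f x : R^o).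
Proof.
move=> FF; pose ev (y : X) : {ptws dual X -> R^o} := fun f => f y.
have ev_cvg : {ptws, ev @ F --> ev x} <->
    forall f : dual X, (fun y => f y : R^o) @ F --> (f x : R^o).
  by apply: iff_trans (pointwise_cvgP _ _) _.
split=> [Fx|Fx].
  apply/ev_cvg; apply: cvg_trans (@initial_continuous X _ ev x).
  exact: cvg_app.
move=> U [_ [[W oW <-] Wx WU]]; apply: filterS WU _.
by apply: (ev_cvg.2 Fx); rewrite nbhsE; exists W.
Qed.

Lemma weak_continuous_dual (f : dual X) : continuous (f : weak_space X -> R^o).
Proof.
by move=> x; apply: (weak_cvgP x (nbhs_filter (x : weak_space X))).1.
Qed.

End weak_topology.

Section weak_space_normed.
Variables (R : realType) (X : completeNormedModType R).

Lemma normed_dual_sep (x y : X) : (forall f : dual X, f x = f y) -> x = y.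
Proof.
move=> fxy; have sn : sublinear (fun z : X => `|z|).
  split=> [u v|a u a0]; first exact: ler_normD.
  by rewrite normrZ ger0_norm.
have [h [lh hn hxy]] := hahn_banach_at (x - y) sn.
have [f fh] : exists f : dual X, forall z, f z = h z.
  apply: exists_dual => //; apply: tvs_linear_continuous => //.
  apply: (@filterS _ _ _ (ball (0 : X) 1)); last exact: nbhsx_ballx.
  move=> z; rewrite -ball_normE /= sub0r normrN => z1.
  by rewrite (le_lt_trans _ z1)// linear_bound_abs// => u; exact: normrN.
by apply/eqP; rewrite -subr_eq0 -normr_eq0 -hxy -fh dual_sub fxy subrr.
Qed.

Lemma weak_space_hausdorff : hausdorff_space (weak_space X).
Proof.
move=> x y xy; apply: normed_dual_sep => f; apply: (@Rhausdorff R).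
move=> A B /(weak_continuous_dual (x := x)) Ax.
move=> /(weak_continuous_dual (x := y)) By.
by have [z [Az Bz]] := xy _ _ Ax By; exists (f z).
Qed.

End weak_space_normed.

(** Along an ultrafilter every functional has a limit, its values on the interval lying in a compact
    segment. After translation to [[0, b - a]], [weak_limit_interval] represents these limits by an
    element. *)
Lemma order_interval_weakly_compact (R : realType) (V : lcsRieszType R)
    (a b : V) : monotone_complete V ->
  compact (order_interval a b : set (weak_space V)).
Proof.
move=> mV; rewrite compact_ultra => F FU Fab.
have FF : ProperFilter (F : set_system V) := ultra_proper.
have [c [ac cb]] := filter_ex Fab.
have z0 : 0 <= b - a by rewrite rsubr_ge0 (le_trans ac).
pose G := (fun x : V => x - a) @ (F : set_system V).
have GF : ProperFilter G by exact: fmap_proper_filter.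
have Gz : F [set x : V | order_interval 0 (b - a) (x - a)].
  apply: filterS Fab => x [ax xb] /=.
  by split; rewrite ?rsubr_ge0// rlerD2r.
have /choice[phi Gphi] (g : dual V) :
    exists l : R^o, (fun x => g x : R^o) @ G --> l.
  have [p cp gp] := dual_le_seminorm g.
  have Gp : G [set x | `[- p (b - a), p (b - a)]%classic (g x : R^o)].
    apply: filterS Gz => x [x0 xb] /=.
    rewrite in_itv/= -ler_norml (le_trans (gp x))//.
    by case: cp => sp _; exact: seminorm_le.
  have := @segment_compact R (- p (b - a)) (p (b - a)).
  rewrite compact_ultra => /(_ ((fun x => g x : R^o) @ G)).
  have FU' : UltraFilter ((fun x => g x : R^o) @ G).
    by do 2 apply: fmap_ultra.
  by move=> /(_ FU' Gp)[l [_ Gl]]; exists l.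
have [v [[v0 vz] vphi]] := weak_limit_interval mV z0 GF Gz Gphi.
exists (v + a); split.
  split; first by rewrite -[X in X <= _]add0r rlerD2r.
  by rewrite -rlerBrDr.
apply/weak_cvgP => f.
rewrite (_ : (fun y => f y : R^o) =
  (fun y => (f (y - a) : R^o) + f a)); last first.
  by apply/funext => y; rewrite dual_sub subrK.
rewrite dual_add; apply: cvgD; last exact: cvg_cst.
by rewrite vphi; exact: Gphi.
Qed.

Lemma tvs_bounded_image (R : realType) (E H : tvsType R) (Q : {linear E -> H})
    (A : set E) : continuous Q -> tvs_bounded A -> tvs_bounded (Q @` A).
Proof.
move=> cQ bA U U0; have : nbhs 0 (Q @^-1` U).
  by apply: cQ; rewrite linear0.
move=> /bA; apply: filterS => r AU _ [x /AU[y Uy <-] <-].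
by exists (Q y) => //; rewrite linearZ.
Qed.

Lemma lattice_homomorphism_le (R : realType) (E H : rieszType R)
    (Q : {linear E -> H}) x y : lattice_homomorphism Q -> x <= y -> Q x <= Q y.
Proof.
move=> lQ xy; have [+ _] := lQ x y; rewrite riesz_join_r// => ->.
exact: join_ubl.
Qed.

(** * Factorization implies generalized b-weak compactness *)

Section factorization_through_KR.
Variables (R : realType) (E H : lcsRieszType R) (Q : {linear E -> H}).
Hypotheses (hK : KR_space H) (cQ : continuous Q) (lQ : lattice_homomorphism Q).

Lemma KR_image_ubound (phi : bidual E) (a : E) :
  bidual_le (bidual_embed a) phi ->
  exists b : H, forall x, bidual_le (bidual_embed x) phi -> Q x <= b.
Proof.
move=> aphi.
pose D := [set x : E | a <= x /\ bidual_le (bidual_embed x) phi].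
have dirD : up_directed D.
  split; first by exists a.
  move=> x y [ax xphi] [ay yphi]; exists (x \v y); split.
  - split; last exact: bidual_le_join.
    by rewrite (le_trans ax)// join_ubl.
  - exact: join_ubl.
  - exact: join_ubr.
have dirI := directed_sig dirD.
pose q (i : {x | D x}) := Q (sval i - a).
have q0 i : 0 <= q i.
  rewrite -(linear0 Q); apply: lattice_homomorphism_le => //.
  by rewrite rsubr_ge0; case: (svalP i).
have qmono i j : sval i <= sval j -> q i <= q j.
  by move=> ij; apply: lattice_homomorphism_le; rewrite // rlerD2r.
(* Translated by [a], the set [D] is positive and lies below [phi - bidual_embed a], hence is
   bounded. *)
have bq : tvs_bounded (range q).
  have := tvs_bounded_image cQ (bidual_le_bounded (phi - bidual_embed a)).
  move=> bA U /bA; apply: filterS => r AU _ [[x [ax xphi]] _ <-].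
  apply: AU; exists (x - a) => //; split; first by rewrite rsubr_ge0.
  move=> f f0; rewrite dualBE lerBrDr.
  by rewrite -[leLHS]/(f (x - a) + f a) -dual_add subrK; exact: xphi.
have [l ql] := hK dirI q0 qmono bq.
have [l1 _ _] := increasing_net_lim dirI qmono ql.
exists (l + Q a) => x xphi.
(* An arbitrary [x] below [phi] need not dominate [a], but its join with [a] is in [D]. *)
have Dxa : D (x \v a) by split; [exact: join_ubr|exact: bidual_le_join].
rewrite -rlerBlDr (le_trans _ (l1 (exist _ _ Dxa)))// /q /= linearB rlerD2r.
by apply: lattice_homomorphism_le => //; exact: join_ubl.
Qed.

Lemma KR_image_order_bounded (A : set E) : b_order_bounded A -> A !=set0 ->
  exists a b : H, Q @` A `<=` order_interval a b.
Proof.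
move=> [u [v uAv]] [a0 Aa0].
have [b hb] := KR_image_ubound (uAv _ Aa0).2.
(* A lower bound is obtained as an upper bound for the opposite set. *)
have [|c hc] := @KR_image_ubound (- u) (- a0).
  move=> f f0; rewrite dualNE -[leLHS]/(f (- a0)) dual_opp lerN2.
  exact: (uAv _ Aa0).1.
exists (- c), b => _ [x Ax <-]; split; last exact/hb/(uAv _ Ax).2.
rewrite rlerNl -linearN; apply: hc => f f0.
by rewrite dualNE -[leLHS]/(f (- x)) dual_opp lerN2; exact: (uAv _ Ax).1.
Qed.

Lemma KR_factor_generalized_b_weakly_compact (X : completeNormedModType R)
    (T : {linear E -> X}) (S : {linear H -> X}) :
  continuous (S : H -> weak_space X) -> T =1 S \o Q ->
  generalized_b_weakly_compact T.
Proof.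
move=> cS TSQ A bA; have [A0|A0] := pselect (A !=set0); last first.
  rewrite (_ : T @` A = set0); last first.
    by apply/seteqP; split=> // y [x Ax _]; apply: A0; exists x.
  by apply: (compact_precompact (@weak_space_hausdorff R X)); exact: compact0.
have [a [b Qab]] := KR_image_order_bounded bA A0.
have TA : T @` A `<=` S @` order_interval a b.
  by move=> _ [x Ax <-]; rewrite TSQ; exists (Q x) => //; apply: Qab; exists x.
apply: (@precompact_subset (weak_space X) _ _ TA).
apply: (compact_precompact (@weak_space_hausdorff R X)).
have cab := @order_interval_weakly_compact _ _ a b (KR_monotone_complete hK).
(* Composing [S] with a functional of [X] gives a functional of [H], so [S] is also continuous from
   weak to weak and preserves weak compactness. *)
have cSw : continuous (S : weak_space H -> weak_space X).
  move=> x; have FF := fmap_filter S (nbhs_filter (x : weak_space H)).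
  apply/(weak_cvgP (S x) FF) => f.
  have [g gf] : exists g : dual H, forall y, g y = f (S y).
    apply: exists_dual.
      by move=> c y y'; rewrite linearP dual_add dual_scale.
    move=> y; apply: (@continuous_comp H (weak_space X) R^o S f y).
      exact: cS.
    exact: weak_continuous_dual.
  have := @weak_continuous_dual _ _ g x.
  rewrite /continuous_at gf (_ : dual_fun g = fun y => f (S y))//.
  exact/funext.
exact: (continuous_compact (continuous_subspaceT cSw) cab).
Qed.

End factorization_through_KR.

(** * A KR-space containing the given space *)

Section approximable.
Variables (R : realType) (E : lcsRieszType R).
Implicit Types (a b c phi psi : bidual E) (f : dual E).

Definition approximable a : Prop :=
  forall f (e : R), dual_ge0 f -> 0 < e ->
  exists x : E, [/\ 0 <= x, bidual_le (bidual_embed x) a & a f - e < f x].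

Lemma approximable_ge0 a f : approximable a -> dual_ge0 f -> 0 <= a f.
Proof.
move=> aa f0; have [x [x0 xa _]] := aa f 1 f0 ltr01.
exact: le_trans (f0 x x0) (xa f f0).
Qed.

Lemma approximable_embed (x : E) : 0 <= x -> approximable (bidual_embed x).
Proof.
move=> x0 f e f0 e0; exists x; split=> //.
by rewrite -[ltLHS]/(f x - e) ltrBlDr ltrDl.
Qed.

Lemma approximableD a b : approximable a -> approximable b ->
  approximable (a + b).
Proof.
move=> aa ab f e f0 e0; have e20 : 0 < e / 2 by rewrite divr_gt0.
have [x [x0 xa xe]] := aa f _ f0 e20; have [y [y0 yb ye]] := ab f _ f0 e20.
exists (x + y); split; first exact: raddr_ge0.
  move=> g g0; rewrite dualDE -[leLHS]/(g (x + y)) dual_add.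
  exact: lerD (xa g g0) (yb g g0).
by rewrite dualDE dual_add; move: xe ye; lra.
Qed.

Lemma approximableZ (r : R) a : 0 <= r -> approximable a ->
  approximable (r *: a).
Proof.
(* Dividing by [r + 1] rather than [r] covers [r = 0]. *)
move=> r0 aa f e f0 e0; have d0 : 0 < e / (r + 1) by rewrite divr_gt0//; lra.
have [x [x0 xa xe]] := aa f _ f0 d0.
exists (r *: x); split; first exact: riesz_scaler_ge0.
  move=> g g0; rewrite dualZE -[leLHS]/(g (r *: x)) dual_scale.
  exact: ler_wpM2l (xa g g0).
have ed : e = (r + 1) * (e / (r + 1)).
  by rewrite mulrC divfK// gt_eqF//; lra.
have : 0 <= r * (f x - (a f - e / (r + 1))).
  by rewrite mulr_ge0//; move: xe; lra.
by rewrite dualZE dual_scale; move: ed d0; set t := e / (r + 1); lra.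
Qed.

Lemma approximable_sup (D : set E) : up_directed D ->
  (forall x, D x -> 0 <= x) ->
  (forall f, dual_ge0 f -> exists M, forall x, D x -> f x <= M) ->
  exists a, [/\ approximable a, forall x, D x -> bidual_le (bidual_embed x) a &
    forall f (e : R), dual_ge0 f -> 0 < e -> exists x, D x /\ a f - e < f x].
Proof.
move=> dirD D0 Dbdd; have [a [aD Da]] := exists_bidual_sup dirD D0 Dbdd.
exists a; split=> // f e f0 e0; have [x [Dx xe]] := Da f e f0 e0.
by exists x; split=> //; [exact: D0|exact: aD].
Qed.

(** The join is the supremum of the [x \v y] with [x, y >= 0] in [E] below [a] and [b]. These are
    bounded because [x \v y <= x + y], and [bidual_le_join] makes their supremum least among all
    upper bounds in the bidual. *)
Lemma approximable_join a b : approximable a -> approximable b ->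
  exists c, [/\ approximable c, bidual_le a c, bidual_le b c &
    forall phi, bidual_le a phi -> bidual_le b phi -> bidual_le c phi].
Proof.
move=> aa ab.
pose L a := [set x : E | 0 <= x /\ bidual_le (bidual_embed x) a].
have LJ d x y : L d x -> L d y -> L d (x \v y).
  move=> [x0 xd] [_ yd]; split; last exact: bidual_le_join.
  exact: le_trans x0 (join_ubl _ _).
pose D := [set w | exists x y, [/\ L a x, L b y & w = x \v y]].
have a0 := approximable_ge0 aa; have b0 := approximable_ge0 ab.
have La0 : L a 0.
  by split=> // f f0; rewrite -[leLHS]/(f 0) dual_apply0 a0.
have Lb0 : L b 0.
  by split=> // f f0; rewrite -[leLHS]/(f 0) dual_apply0 b0.
have [|_ [x [y [[x0 _] _ ->]]]|f f0|c [ac cD Dc]] := @approximable_sup D.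
- split; first by exists (0 \v 0), 0, 0.
  move=> _ _ [x [y [Lx Ly ->]]] [x' [y' [Lx' Ly' ->]]].
  exists ((x \v x') \v (y \v y')); split.
  - by exists (x \v x'), (y \v y'); split=> //; exact: LJ.
  - by apply: join_le; exact: join_ubl.
  - by apply: join_le; exact: join_ubr.
- exact: le_trans x0 (join_ubl _ _).
- exists (a f + b f) => _ [x [y [[x0 xa] [y0 yb] ->]]].
  rewrite (le_trans _ (lerD (xa f f0) (yb f f0)))//.
  rewrite -[leRHS]/(f x + f y) -dual_add dual_ge0_le// riesz_leUx.
  by rewrite -{1}[x]addr0 -{2}[y]add0r rlerD2l rlerD2r x0 y0.
have le_c d : approximable d -> (forall x, L d x -> exists2 w, D w & x <= w) ->
    bidual_le d c.
  move=> ad Lc f f0; apply/ler_addgt0Pr => e e0.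
  have [x [x0 xd xe]] := ad f e f0 e0.
  have [w Dw xw] := Lc x (conj x0 xd); have := cD w Dw f f0.
  by rewrite -[leLHS]/(f w); have := dual_ge0_le f0 xw; move: xe; lra.
exists c; split=> //.
- by apply: le_c => // x Lx; exists (x \v 0); [exists x, 0|exact: join_ubl].
- by apply: le_c => // y Ly; exists (0 \v y); [exists 0, y|exact: join_ubr].
- move=> phi aphi bphi f f0; apply/ler_addgt0Pr => e e0.
  have [_ [[x [y [[_ xa] [_ yb] ->]]] we]] := Dc f e f0 e0.
  have := bidual_le_join (bidual_le_trans xa aphi) (bidual_le_trans yb bphi).
  by move=> /(_ f f0); rewrite -[leLHS]/(f (x \v y)); move: we; lra.
Qed.

(* An approximant [x] of [a] is corrected by [z = sup {x /\ y : 0 <= y <= b}],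
   which lies in [E]: then [x - z] approximates [a - b]. *)
Lemma approximableB a b : monotone_complete E -> approximable a ->
  approximable b -> bidual_le b a -> approximable (a - b).
Proof.
move=> mE aa ab ba f e f0 e0; have [x [x0 xa xe]] := aa f e f0 e0.
have b0 := approximable_ge0 ab.
pose L := [set y : E | 0 <= y /\ bidual_le (bidual_embed y) b].
have [||z [z1 z2 z3]] := mE [set x \^ y | y in L].
- split; first by exists (x \^ 0), 0 => //; split=> // g g0;
    rewrite -[leLHS]/(g 0) dual_apply0 b0.
  move=> _ _ [y [y0 yb] <-] [y' [y'0 y'b] <-]; exists (x \^ (y \v y')).
  split.
  - exists (y \v y') => //; split; last exact: bidual_le_join.
    exact: le_trans y0 (join_ubl _ _).
  - apply: meet_glb; first exact: meet_lbl.
    exact: le_trans (meet_lbr _ _) (join_ubl _ _).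
  - apply: meet_glb; first exact: meet_lbl.
    exact: le_trans (meet_lbr _ _) (join_ubr _ _).
- by exists x => _ [y _ <-]; exact: meet_lbl.
exists (x - z); split.
- by rewrite rsubr_ge0; apply: z2 => _ [y _ <-]; exact: meet_lbl.
- move=> g g0; rewrite dualBE -[leLHS]/(g (x - z)) dual_sub.
  (* From [x \^ y <= z] and [x \v y] below [a] follows that [x - z <= (x \v y) - y] lies below
     [a - y], where [y] approximates [b] at [g]. *)
  apply/ler_addgt0Pr => d d0; have [y [y0 yb ye]] := ab g d g0 d0.
  have := dual_ge0_le g0 (z1 _ (ex_intro2 _ _ y (conj y0 yb) erefl)).
  have := bidual_le_join xa (bidual_le_trans yb ba) g0.
  rewrite -[leLHS]/(g (x \v y)); have := joinD_meet x y.
  move=> /(congr1 (g : E -> R)); rewrite !dual_add; move: ye; lra.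
- have zb : f z <= b f.
    apply/ler_addgt0Pr => d d0; have [_ [[y [_ yb] <-] yd]] := z3 f d f0 d0.
    have := dual_ge0_le f0 (meet_lbr x y); have := yb f f0.
    by rewrite -[leLHS]/(f y); move: yd; lra.
  by rewrite dualBE dual_sub; move: xe zb; lra.
Qed.

End approximable.

(** * The Riesz space of differences of approximable elements *)

Section hull.
Variables (R : realType) (E : lcsRieszType R).

(* The lattice generated in the bidual by the suprema of upward directed subsets
   of the positive cone of [E]. *)
Definition hull_set : set (bidual E) :=
  [set phi | exists a b, [/\ approximable a, approximable b & phi = a - b]].

Definition hull_pred : {pred bidual E} := fun phi => phi \in hull_set.

Lemma hull_submod_closed : submod_closed hull_pred.
Proof.
split.
  rewrite unfold_in inE; exists (bidual_embed 0), (bidual_embed 0).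
  by split; rewrite ?subrr//; exact: approximable_embed.
move=> r phi psi; rewrite !unfold_in !inE.
move=> [a [b [aa ab ->]]] [c [d [ac ad ->]]].
have [r0|r0] := leP 0 r.
  exists (r *: a + c), (r *: b + d); split.
  - by apply: approximableD => //; exact: approximableZ.
  - by apply: approximableD => //; exact: approximableZ.
  - by rewrite scalerBr opprD addrACA.
have Nr0 : 0 <= - r by rewrite oppr_ge0 ltW.
exists ((- r) *: b + c), ((- r) *: a + d); split.
- by apply: approximableD => //; exact: approximableZ.
- by apply: approximableD => //; exact: approximableZ.
- by rewrite scalerBr opprD !scaleNr opprK [r *: a - _]addrC addrACA.
Qed.

HB.instance Definition _ :=
  GRing.isSubmodClosed.Build R (bidual E) hull_pred hull_submod_closed.

Definition hull : Type := {phi : bidual E | phi \in hull_pred}.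

HB.instance Definition _ := SubChoice.on hull.
HB.instance Definition _ := [SubChoice_isSubLmodule of hull by <:].

Definition hull_val (phi : hull) : bidual E := val phi.
Coercion hull_val : hull >-> dual.

Implicit Types phi psi theta : hull.

Lemma hull_valP phi : exists a b,
  [/\ approximable a, approximable b & hull_val phi = a - b].
Proof. by have := valP phi; rewrite unfold_in inE. Qed.

Lemma exists_hull (a b : bidual E) : approximable a -> approximable b ->
  exists phi, hull_val phi = a - b.
Proof.
move=> aa ab; have h : a - b \in hull_pred.
  by rewrite unfold_in inE; exists a, b.
by exists (exist _ (a - b) h).
Qed.

Lemma exists_hull1 (a : bidual E) : approximable a ->
  exists phi, hull_val phi = a.
Proof.
move=> aa; have [|phi e] := @exists_hull a 0 aa.
  rewrite (_ : 0 = bidual_embed 0); first exact: approximable_embed.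
  by apply: dual_ext => f; rewrite -[RHS]/((f : dual E) 0) dual_apply0.
by exists phi; rewrite e subr0.
Qed.

Definition hull_le phi psi : bool :=
  `[< bidual_le (hull_val phi) (hull_val psi) >].

Lemma hull_le_refl : reflexive hull_le.
Proof. by move=> phi; apply/asboolP. Qed.

Lemma hull_le_anti : antisymmetric hull_le.
Proof.
move=> phi psi /andP[/asboolP h /asboolP k]; apply: val_inj.
by apply: bidual_ext => f f0; apply/eqP; rewrite eq_le h// k.
Qed.

Lemma hull_le_trans : transitive hull_le.
Proof.
move=> psi phi theta /asboolP h /asboolP k; apply/asboolP.
exact: bidual_le_trans h k.
Qed.

HB.instance Definition _ := Order.Le_isPOrder.Build ring_display hull
  hull_le_refl hull_le_anti hull_le_trans.

Lemma hull_leP phi psi :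
  reflect (forall f : dual E, dual_ge0 f -> phi f <= psi f) (phi <= psi).
Proof. exact: asboolP. Qed.

Lemma hullDE phi psi (f : dual E) : (phi + psi : hull) f = phi f + psi f.
Proof. by []. Qed.

Lemma hullNE phi (f : dual E) : (- phi : hull) f = - phi f.
Proof. by []. Qed.

Lemma hullBE phi psi (f : dual E) : (phi - psi : hull) f = phi f - psi f.
Proof. by []. Qed.

Lemma hullZE (r : R) phi (f : dual E) : (r *: phi : hull) f = r * phi f.
Proof. by []. Qed.

Lemma hull0E (f : dual E) : (0 : hull) f = 0.
Proof. by []. Qed.

(** Translation by [b + d] reduces the join of [a - b] and [c - d] to that of the approximable
    elements [a + d] and [c + b]. *)
Lemma hull_join_subproof phi psi : exists theta, forall chi : hull,
  (theta <= chi) = (phi <= chi) && (psi <= chi).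
Proof.
have [a [b [aa ab eab]]] := hull_valP phi.
have [c [d [ac ad ecd]]] := hull_valP psi.
have [s [as_ s1 s2 s3]] :=
  approximable_join (approximableD aa ad) (approximableD ac ab).
have [theta et] := exists_hull as_ (approximableD ab ad).
have phiE f : phi f = a f - b f by rewrite eab.
have psiE f : psi f = c f - d f by rewrite ecd.
have thetaE f : theta f = s f - (b f + d f) by rewrite et.
exists theta => chi; apply/idP/andP => [/hull_leP tc|].
  split; apply/hull_leP => f f0; apply: le_trans (tc f f0).
    by have := s1 f f0; rewrite dualDE thetaE phiE; lra.
  by have := s2 f f0; rewrite dualDE thetaE psiE; lra.
move=> [/hull_leP pc /hull_leP qc]; apply/hull_leP => f f0.
have := s3 (hull_val chi + b + d).
have h1 : bidual_le (a + d) (hull_val chi + b + d).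
  by move=> g g0; have := pc g g0; rewrite !dualDE phiE; lra.
have h2 : bidual_le (c + b) (hull_val chi + b + d).
  by move=> g g0; have := qc g g0; rewrite !dualDE psiE; lra.
by move=> /(_ h1 h2 f f0); rewrite !dualDE thetaE; lra.
Qed.

Definition hull_join phi psi : hull := sval (cid (hull_join_subproof phi psi)).
Definition hull_meet phi psi : hull := - hull_join (- phi) (- psi).

Lemma hull_leUx phi psi theta :
  (hull_join phi psi <= theta) = (phi <= theta) && (psi <= theta).
Proof. by rewrite /hull_join; case: cid. Qed.

Lemma hull_leN2 phi psi : (- phi <= - psi) = (psi <= phi).
Proof.
by apply/hull_leP/hull_leP => h f f0; have := h f f0; rewrite !hullNE lerN2.
Qed.

Lemma hull_lexI phi psi theta :
  (theta <= hull_meet phi psi) = (theta <= phi) && (theta <= psi).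
Proof.
by rewrite /hull_meet -{1}[theta]opprK hull_leN2 hull_leUx !hull_leN2.
Qed.

Lemma hull_lerD2l theta phi psi : phi <= psi -> theta + phi <= theta + psi.
Proof.
by move=> /hull_leP h; apply/hull_leP => f f0; rewrite !hullDE lerD2l h.
Qed.

Lemma hull_scaler_ge0 (r : R) phi : 0 <= r -> 0 <= phi -> 0 <= r *: phi.
Proof.
move=> r0 /hull_leP h; apply/hull_leP => f f0.
by rewrite hullZE mulr_ge0// -(hull0E f) h.
Qed.

Lemma hull_archimedean phi psi :
  0 <= phi -> (forall n : nat, phi *+ n <= psi) -> phi = 0.
Proof.
move=> phi0 h; apply/eqP; rewrite eq_le phi0 andbT; apply/hull_leP => f f0.
rewrite hull0E leNgt; apply/negP => pf.
have := h (Num.bound (`|psi f| / phi f)) => /hull_leP/(_ f f0).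
rewrite -scaler_nat hullZE leNgt => /negP; apply.
have q0 : 0 <= `|psi f| / phi f by rewrite divr_ge0// ltW.
rewrite -ltr_pdivrMr//; apply: le_lt_trans (archi_boundP q0).
by rewrite ler_pM2r ?invr_gt0// ler_norm.
Qed.

HB.instance Definition _ := POrderedLmodule_isRieszSpace.Build R hull
  hull_leUx hull_lexI hull_lerD2l hull_scaler_ge0 hull_archimedean.

End hull.

(** * The locally convex-solid topology of the hull *)

Section hull_topology.
Variables (R : realType) (E : lcsRieszType R).
Implicit Types (phi psi theta : hull E) (f g : dual E).

(* Locked because failed conversion tests would otherwise unfold the whole order
   structure of [hull E]. *)
Definition hull_seminorm : dual E -> hull E -> R :=
  locked (fun f phi => (riesz_abs phi : hull E) f).

Local Notation N := hull_seminorm.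

Lemma hull_seminormE f phi : N f phi = (riesz_abs phi : hull E) f.
Proof. by rewrite /hull_seminorm -lock. Qed.

Lemma hull_seminormP f : dual_ge0 f -> riesz_seminorm (N f).
Proof.
move=> f0; split=> [phi psi|r phi|phi psi /hull_leP/(_ f f0)].
- by have /hull_leP/(_ f f0) := abs_subadd phi psi; rewrite !hull_seminormE.
- by rewrite !hull_seminormE absZ hullZE.
- by rewrite !hull_seminormE.
Qed.

Lemma hull_seminormD f g phi : N (f + g) phi = N f phi + N g phi.
Proof. by rewrite !hull_seminormE dual_add. Qed.

Lemma hull_seminormZ (r : R) f phi : N (r *: f) phi = r * N f phi.
Proof. by rewrite !hull_seminormE dual_scale. Qed.

Lemma hull_seminorm_ge0 f phi : dual_ge0 f -> 0 <= N f phi.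
Proof. by move=> f0; exact/seminorm_ge0/hull_seminormP. Qed.

Lemma hull_norm_le f phi : dual_ge0 f -> `|phi f| <= N f phi.
Proof.
move=> f0; rewrite hull_seminormE ler_norml lerNl -hullNE.
have /hull_leP/(_ f f0) -> := abs_geN phi.
by have /hull_leP/(_ f f0) -> := abs_ge phi.
Qed.

Lemma hull_seminorm_ge0E f phi : 0 <= phi -> N f phi = phi f.
Proof. by move=> phi0; rewrite hull_seminormE ge0_abs. Qed.

Definition hull_ball f phi : set (hull E) := [set psi | N f (psi - phi) < 1].

(** Unit balls of single functionals form a base: the seminorms are additive and homogeneous in [f],
    so sums of functionals replace intersections and multiples replace radii. *)
Definition hull_nbhs phi : set_system (hull E) :=
  filter_from [set f | dual_ge0 f] (hull_ball^~ phi).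

Lemma hull_ball_center f phi : dual_ge0 f -> hull_ball f phi phi.
Proof.
by move=> f0; rewrite /hull_ball /= subrr (seminorm0 (hull_seminormP f0)).
Qed.

Lemma hull_seminorm_triangle f phi psi theta : dual_ge0 f ->
  N f (phi - theta) <= N f (phi - psi) + N f (psi - theta).
Proof.
move=> /hull_seminormP[sD _ _].
by have := sD (phi - psi) (psi - theta); rewrite addrA subrK.
Qed.

Lemma hull_nbhs_filter phi : ProperFilter (hull_nbhs phi).
Proof.
apply: filter_from_proper; last first.
  by move=> f f0; exists phi; exact: hull_ball_center.
apply: filter_from_filter; first by exists 0; exact: dual_ge00.
move=> f g f0 g0; exists (f + g); first exact: dual_ge0D.
move=> psi; rewrite /hull_ball /= hull_seminormD => h; split=> /=;
  by apply: le_lt_trans h; rewrite ?lerDl ?lerDr hull_seminorm_ge0.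
Qed.

Lemma hull_nbhs_singleton phi (A : set (hull E)) : hull_nbhs phi A -> A phi.
Proof. by move=> [f f0 fA]; apply: fA; exact: hull_ball_center. Qed.

Lemma hull_nbhs_lt f phi (r : R) : dual_ge0 f -> 0 < r ->
  hull_nbhs phi [set psi | N f (psi - phi) < r].
Proof.
move=> f0 r0; exists (r^-1 *: f).
  by apply: dual_ge0Z => //; rewrite invr_ge0 ltW.
by move=> psi; rewrite /hull_ball /= hull_seminormZ mulrC ltr_pdivrMr// mul1r.
Qed.

Lemma hull_ball_open f phi psi : dual_ge0 f -> hull_ball f phi psi ->
  hull_nbhs psi (hull_ball f phi).
Proof.
move=> f0 fpsi; have d0 : 0 < 1 - N f (psi - phi) by rewrite subr_gt0.
have [g g0 gd] := hull_nbhs_lt psi f0 d0; exists g => //.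
move=> theta /gd; rewrite /hull_ball /= ltrBrDr; apply: le_lt_trans.
exact: hull_seminorm_triangle.
Qed.

Lemma hull_nbhs_nbhs phi (A : set (hull E)) :
  hull_nbhs phi A -> hull_nbhs phi (hull_nbhs^~ A).
Proof.
move=> [f f0 fA]; exists f => // psi /(hull_ball_open f0)[g g0 gf].
by exists g => //; exact: subset_trans gf fA.
Qed.

HB.instance Definition _ := hasNbhs.Build (hull E) hull_nbhs.
HB.instance Definition _ := Nbhs_isNbhsTopological.Build (hull E)
  hull_nbhs_filter hull_nbhs_singleton hull_nbhs_nbhs.

Lemma hull_add_continuous : continuous (fun x : hull E * hull E => x.1 + x.2).
Proof.
move=> [phi psi] U [f f0 fU]; have h : 0 < 2^-1 :> R by rewrite invr_gt0.
exists ([set x | N f (x - phi) < 2^-1], [set x | N f (x - psi) < 2^-1]).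
  by split; exact: hull_nbhs_lt.
move=> [x y] [/= xphi ypsi]; apply: fU; rewrite /hull_ball /=.
have [sD _ _] := hull_seminormP f0.
rewrite opprD addrACA (le_lt_trans (sD _ _))// [1]splitr !div1r.
exact: ltrD.
Qed.

Lemma hull_scale_continuous :
  continuous (fun z : R^o * hull E => z.1 *: z.2).
Proof.
move=> [r phi] U [f f0 fU]; have h : 0 < 2^-1 :> R by rewrite invr_gt0.
have [sD sZ _] := hull_seminormP f0.
have p0 := hull_seminorm_ge0 phi f0.
(* The radii keep both terms of [s *: (x - phi) + (s - r) *: phi] within one half, the absolute
   value of [s] exceeding that of [r] by at most 1. *)
have b0 : 0 < (2 * (`|r| + 1))^-1.
  by rewrite invr_gt0 mulr_gt0// ltr_wpDl.
have c0 : 0 < (2 * (N f phi + 1))^-1 by rewrite invr_gt0 mulr_gt0// ltr_wpDl.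
exists ([set s : R^o | `|s - r| < Num.min 1 (2 * (N f phi + 1))^-1],
    [set x | N f (x - phi) < (2 * (`|r| + 1))^-1]).
  split; last exact: hull_nbhs_lt.
  have d0 : 0 < Num.min 1 (2 * (N f phi + 1))^-1 by rewrite lt_min ltr01.
  have := nbhsx_ballx (r : R^o) _ d0; rewrite -ball_normE.
  by apply: filterS => s /=; rewrite distrC.
move=> [s x] [/= + xphi]; rewrite lt_min => /andP[s1 sr].
apply: fU; rewrite /hull_ball /=.
have -> : s *: x - r *: phi = s *: (x - phi) + (s - r) *: phi.
  by rewrite scalerBr scalerBl addrA subrK.
apply: le_lt_trans (sD _ _) _; rewrite !sZ.
have h1 : `|s| * N f (x - phi) <= 2^-1.
  have : `|s| <= `|r| + 1.
    by have := ler_normD (s - r) r; rewrite subrK; move: s1; lra.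
  move=> sr1; apply: le_trans (ler_wpM2r (hull_seminorm_ge0 _ f0) sr1) _.
  by move: xphi; rewrite invfM ltr_pdivlMr ?ltr_wpDl// mulrC => /ltW.
have h2 : `|s - r| * N f phi < 2^-1.
  have : `|s - r| * N f phi <= `|s - r| * (N f phi + 1).
    by rewrite ler_wpM2l// lerDl.
  move: sr; rewrite invfM ltr_pdivlMr ?ltr_wpDl//.
  by move=> k1 k2; exact: le_lt_trans k2 k1.
by rewrite [1]splitr !div1r; exact: ler_ltD.
Qed.

Lemma hull_locally_convex : exists2 B : set_system (hull E),
  (forall b, b \in B -> convex_set b) & basis B.
Proof.
exists [set b | exists f phi, dual_ge0 f /\ b = hull_ball f phi].
  move=> b; rewrite inE => -[f [phi [f0 ->]]]; apply/convex_setW.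
  move=> x y; rewrite !inE => xb yb k k0 k1; rewrite inE.
  have [sD sZ _] := hull_seminormP f0.
  have k1' : 0 < 1 - k%:num by rewrite subr_gt0.
  have e : k%:num *: x + (1 - k%:num) *: y - phi =
      k%:num *: (x - phi) + (1 - k%:num) *: (y - phi).
    rewrite ![_ *: (_ - phi)]scalerBr addrACA -opprD -scalerDl.
    by rewrite [k%:num + _]addrC subrK scale1r.
  rewrite /hull_ball /= -[X in X - phi]/(k%:num *: x + (1 - k%:num) *: y) e.
  apply: le_lt_trans (sD _ _) _; rewrite !sZ !gtr0_norm//.
  rewrite [ltRHS](_ : 1 = k%:num * 1 + (1 - k%:num) * 1); last first.
    by rewrite !mulr1 addrC subrK.
  by apply: ltrD; rewrite ltr_pM2l.
split.
  move=> b [f [phi [f0 ->]]]; rewrite openE => psi; exact: hull_ball_open.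
move=> phi A [f f0 fA]; exists (hull_ball f phi) => //.
by split; [exists f, phi|exact: hull_ball_center].
Qed.

(* Despite its name, this factory only provides the uniform structure. *)
HB.instance Definition _ := PreTopologicalLmod_isTvs.Build R (hull E)
  hull_add_continuous hull_scale_continuous hull_locally_convex.
HB.instance Definition _ :=
  PreTopologicalNmodule_isTopologicalNmodule.Build (hull E) hull_add_continuous.
HB.instance Definition _ :=
  TopologicalNmodule_isTopologicalLmodule.Build R (hull E)
    hull_scale_continuous.
HB.instance Definition _ :=
  Uniform_isTvs.Build R (hull E) hull_locally_convex.

Lemma hull_hausdorff : hausdorff_space (hull E).
Proof.
move=> phi psi h; apply/eqP; rewrite -subr_eq0; apply/eqP/abs_eq0.
apply: val_inj; apply: bidual_ext => f f0.
rewrite -[LHS]hull_seminormE dual0E; apply/eqP.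
rewrite eq_le hull_seminorm_ge0// andbT; apply/ler_addgt0Pr => e e0.
have e20 : 0 < e / 2 by rewrite divr_gt0.
have [x [/= xphi xpsi]] := h _ _ (hull_nbhs_lt phi f0 e20)
  (hull_nbhs_lt psi f0 e20).
have := hull_seminorm_triangle phi x psi f0.
rewrite -(seminormN (x - phi) (hull_seminormP f0)) opprB in xphi.
move=> /le_trans; apply; rewrite add0r [e]splitr.
by apply/ltW/ltrD.
Qed.

Lemma hull_generated :
  generated_by_seminorms [set N f | f in [set f | dual_ge0 f]].
Proof.
move=> phi U; split=> [[f f0 fU]|[F [e [finF FP e0 FU]]]].
  exists [set N f], 1; split=> //; first by move=> _ ->; exists f.
  by move=> psi /= /(_ _ erefl) /fU.
suff [f f0 fF] : exists2 f, dual_ge0 f &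
    forall p, F p -> forall psi, p psi <= N f psi.
  have := hull_nbhs_lt phi f0 e0; apply: filterS => psi /= fe.
  by apply: FU => p Fp; exact: le_lt_trans (fF p Fp _) fe.
have [s Fs] := (finite_seqP F).1 finF.
have {}FP p : p \in s -> exists2 f, dual_ge0 f & N f = p.
  by move=> ps; apply: FP; rewrite Fs.
suff [f f0 fs] : exists2 f, dual_ge0 f &
    forall p, p \in s -> forall psi, p psi <= N f psi.
  by exists f => // p; rewrite Fs; exact: fs.
elim: s FP {Fs} => [|p s ih] FP; first by exists 0 => //; exact: dual_ge00.
have [|f f0 fs] := ih; first by move=> q qs; apply: FP; rewrite inE qs orbT.
have [|g g0 gp] := FP p; first by rewrite inE eqxx.
exists (f + g); first exact: dual_ge0D.
move=> q; rewrite inE => /predU1P[->|qs] psi.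
  by rewrite hull_seminormD -gp lerDr hull_seminorm_ge0.
by rewrite hull_seminormD (le_trans (fs q qs psi))// lerDl hull_seminorm_ge0.
Qed.

Lemma hull_seminorms : exists P : set (hull E -> R),
  (forall p, P p -> riesz_seminorm p) /\ generated_by_seminorms P.
Proof.
exists [set N f | f in [set f | dual_ge0 f]]; split; last exact: hull_generated.
by move=> _ [f f0 <-]; exact: hull_seminormP.
Qed.

HB.instance Definition _ := Tvs_isLocallyConvexSolid.Build R (hull E)
  hull_hausdorff hull_seminorms.

End hull_topology.

(** * The hull is a KR-space containing the given space *)

Section hull_KR.
Variables (R : realType) (E : lcsRieszType R).
Implicit Types (phi psi : hull E) (f g : dual E).

Lemma hull_cont_seminorm f : dual_ge0 f -> cont_seminorm (@hull_seminorm R E f).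
Proof.
move=> f0; split; first exact: hull_seminormP.
apply: (@filterS _ _ (nbhs_filter (0 : hull E))) (hull_nbhs_lt 0 f0 ltr01).
by move=> psi /=; rewrite subr0.
Qed.

Lemma hull_norm_le_jordan f g phi : dual_ge0 f -> dual_ge0 g ->
  `|phi (f - g)| <= hull_seminorm (f + g) phi.
Proof.
move=> f0 g0; rewrite dual_sub hull_seminormD (le_trans (ler_normB _ _))//.
by rewrite lerD ?hull_norm_le.
Qed.

Lemma hull_ge0_approximable phi : monotone_complete E -> 0 <= phi ->
  approximable (hull_val phi).
Proof.
move=> mE /hull_leP phi0; have [a [b [aa ab e]]] := hull_valP phi.
rewrite e; apply: approximableB => // f f0.
by have := phi0 f f0; rewrite hull0E e dualBE subr_ge0.
Qed.

(** The limit is the supremum of the elements of the positive cone of [E] lying below some [x i]. It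
    dominates each [x i] because positive elements of the hull are approximable. *)
Lemma hull_KR_space : monotone_complete E -> KR_space (hull E).
Proof.
move=> mE I leI x dirI x0 xmono bx; have [[i0] refl trans dir] := dirI.
have ax i := hull_ge0_approximable mE (x0 i).
pose D := [set y : E | 0 <= y /\
  exists i, bidual_le (bidual_embed y) (hull_val (x i))].
have [|y []//|f f0|a [aa aD Da]] := @approximable_sup R E D.
- split.
    exists 0; split=> //; exists i0 => f f0.
    rewrite -[leLHS]/(f 0) dual_apply0; exact: approximable_ge0.
  move=> y z [y0 [i yi]] [z0 [j zj]]; have [k [ik jk]] := dir i j.
  exists (y \v z); split; [|exact: join_ubl|exact: join_ubr].
  split; first exact: le_trans y0 (join_ubl _ _).
  exists k; apply: bidual_le_join.
    by apply: bidual_le_trans yi _; apply/hull_leP/xmono.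
  by apply: bidual_le_trans zj _; apply/hull_leP/xmono.
- have [M MD] := (tvs_boundedP _).1 bx _ (hull_cont_seminorm f0).
  exists M => y [_ [i yi]]; apply: le_trans (yi f f0) _.
  rewrite -[leLHS]/((x i : hull E) f) -(hull_seminorm_ge0E f (x0 i)).
  by apply: MD; exists i.
have [phi ephi] := exists_hull1 aa.
have xphi i : x i <= phi.
  apply/hull_leP => f f0; apply/ler_addgt0Pr => e e0.
  have [y [y0 yi ye]] := ax i f e f0 e0.
  have := aD y (conj y0 (ex_intro _ i yi)) f f0.
  by rewrite ephi -[leLHS]/(f y); move: ye; lra.
exists phi => U [f f0 fU].
(* Precision 1 is enough, basic neighborhoods being unit balls. Beyond [i] the net stays between [y]
   and [phi] on [f]. *)
have [y [[y0 [i yi]] ye]] := Da f 1 f0 ltr01.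
exists i => // j /= ij; apply: fU; rewrite /hull_ball /=.
rewrite -(seminormN _ (hull_seminormP f0)) opprB.
rewrite hull_seminorm_ge0E ?rsubr_ge0// hullBE ephi.
have /hull_leP/(_ f f0) := xmono _ _ ij; have := yi f f0.
rewrite -[leLHS]/(f y) => h1 h2; rewrite ltrBlDr addrC -ltrBlDr.
exact: lt_le_trans ye (le_trans h1 h2).
Qed.

Lemma hull_embed_subproof (x : E) : bidual_embed x \in @hull_pred R E.
Proof.
rewrite unfold_in inE.
exists (bidual_embed (riesz_pos x)), (bidual_embed (riesz_pos (- x))).
split; [exact/approximable_embed/pos_ge0|exact/approximable_embed/pos_ge0|].
by apply: dual_ext => f; rewrite -[LHS]/((f : dual E) x) -{1}[x]posB dual_sub.
Qed.

Definition hull_embed (x : E) : hull E :=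
  exist (fun u : bidual E => u \in @hull_pred R E) _ (hull_embed_subproof x).

Lemma hull_embedE x f : hull_embed x f = f x. Proof. by []. Qed.

Lemma hull_embed_linear : linear hull_embed.
Proof.
move=> r x y; apply: val_inj; apply: dual_ext => f.
by rewrite -[LHS]/((f : dual E) (r *: x + y)) dual_add dual_scale.
Qed.

HB.instance Definition _ :=
  GRing.isLinear.Build R E (hull E) _ hull_embed hull_embed_linear.

Lemma hull_embed_le (x y : E) : x <= y -> hull_embed x <= hull_embed y.
Proof.
by move=> xy; apply/hull_leP => f f0; rewrite !hull_embedE dual_ge0_le.
Qed.

Lemma hull_embed_join (x y : E) :
  hull_embed (x \v y) = hull_embed x \v hull_embed y.
Proof.
apply/eqP; rewrite eq_le riesz_leUx !hull_embed_le ?join_ubl ?join_ubr// !andbT.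
have /hull_leP xj := join_ubl (hull_embed x) (hull_embed y).
have /hull_leP yj := join_ubr (hull_embed x) (hull_embed y).
by apply/hull_leP; exact: bidual_le_join xj yj.
Qed.

Lemma hull_embed_lattice_homomorphism : lattice_homomorphism hull_embed.
Proof.
move=> x y; split; first exact: hull_embed_join.
by rewrite !meetE linearB linearD /= hull_embed_join.
Qed.

Lemma hull_embed_continuous : continuous hull_embed.
Proof.
move=> x U [f f0 fU].
have [p cp fp] := dual_le_seminorm f; have [sp _] := cp.
have := cont_seminorm_nbhs x cp (ltr01 : 0 < 1 :> R).
apply: filterS => y /= pyx; apply: fU; rewrite /hull_ball /=.
rewrite hull_seminormE -linearB /riesz_abs -linearN -hull_embed_join.
rewrite hull_embedE (le_lt_trans (ler_norm _))// (le_lt_trans (fp _))//.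
by rewrite -/(riesz_abs _) seminorm_abs.
Qed.

End hull_KR.

(** * Extension of the operator to the hull *)

Section extension.
Variables (R : realType) (E : lcsRieszType R) (X : completeNormedModType R).
Variable T : {linear E -> X}.
Hypotheses (cT : continuous T) (gT : generalized_b_weakly_compact T).

Lemma exists_adjoint (l : dual X) :
  exists f : dual E, forall x, f x = l (T x).
Proof.
apply: exists_dual; first by move=> r x y; rewrite linearP dual_add dual_scale.
by move=> x; apply: continuous_comp; [exact: cT|exact: dual_continuous].
Qed.

(** Along the directed set of positive [x] in [E] below [a], the values [l (T x)] tend to [a f] by
    approximability, and the [T x] have a weak cluster point by hypothesis on [T]. This point is the
    value at [a] of the bitranspose of [T]. *)
Lemma exists_approximable_image (a : bidual E) : approximable a ->
  exists w : X, forall (l : dual X) (f : dual E),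
    (forall x, f x = l (T x)) -> l w = a f.
Proof.
move=> aa; have a0 := approximable_ge0 aa.
pose D := [set x : E | 0 <= x /\ bidual_le (bidual_embed x) a].
have dirD : up_directed D.
  split.
    by exists 0; split=> // f f0; rewrite -[leLHS]/(f 0) dual_apply0 a0.
  move=> x y [x0 xa] [y0 ya]; exists (x \v y).
  split; [split|exact: join_ubl|exact: join_ubr]; last exact: bidual_le_join.
  exact: le_trans x0 (join_ubl _ _).
have dirI := directed_sig dirD; have FF := net_tails_proper dirI.
have bD : b_order_bounded D.
  by exists 0, a => x [x0 xa]; split=> // f f0; exact: f0.
have := gT bD; rewrite precompactE => cptTD.
pose F := net_tails (fun i j : {x | D x} => sval i <= sval j).
pose G : set_system (weak_space X) := (fun i : {x | D x} => T (sval i)) @ F.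
have GF : ProperFilter G by exact: fmap_proper_filter.
have GD : G (closure (T @` D : set (weak_space X))).
  have TD : F [set i | (T @` D) (T (sval i))].
    by apply: filterE => i /=; exists (sval i) => //; exact: (svalP i).
  exact: (filterS (@subset_closure (weak_space X) _) (TD : G (T @` D))).
have [w [_ clw]] := cptTD G GF GD.
exists w => l f fl; have [g [h [g0 h0 fgh]]] := dual_jordan f.
apply/eqP; rewrite -subr_eq0 -normr_le0; apply/ler_addgt0Pr => e e0.
(* One third for each part of the Jordan decomposition of [f], and one for the cluster point. *)
rewrite add0r; have e30 : 0 < e / 3 by rewrite divr_gt0.
have appr k : dual_ge0 k -> F [set i | `|a k - k (sval i)| < e / 3].
  move=> k0; have [x [x0 xa xe]] := aa k _ k0 e30.
  exists (exist _ x (conj x0 xa)) => // i /= xi.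
  have [_ /(_ k k0) ia] := svalP i; rewrite ger0_norm ?subr_ge0//.
  by have := dual_ge0_le k0 xi; move: xe; lra.
have Gf : G [set y | `|a f - l y| < e / 3 + e / 3].
  apply: filterS2 (appr g g0) (appr h h0) => i /= gi hi.
  rewrite -fl fgh dual_sub dualBE.
  have -> : a g - a h - (g (sval i) - h (sval i)) =
      (a g - g (sval i)) - (a h - h (sval i)) by lra.
  by have := ler_normB (a g - g (sval i)) (a h - h (sval i)); move: gi hi; lra.
have Wl : nbhs (w : weak_space X) [set y | `|l w - l y| < e / 3].
  have /cvgrPdist_lt/(_ _ e30) := @weak_continuous_dual _ _ l w.
  by [].
have [y [/= yf yl]] := clw _ _ Gf Wl.
have := ler_normB (l w - l y) (a f - l y).
rewrite (_ : l w - l y - _ = l w - a f); last by lra.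
by move: yf yl; lra.
Qed.

(** Functionals separate the points of [X], so linearity and the factorization are tested on them.
    Weak continuity follows from the bound of [phi (g - h)] by the seminorm of [g + h]. *)
Lemma exists_hull_extension : exists S : {linear hull E -> X},
  continuous (S : hull E -> weak_space X) /\ T =1 S \o @hull_embed R E.
Proof.
have /choice[S hS] (phi : hull E) : exists w : X,
    forall (l : dual X) (f : dual E), (forall x, f x = l (T x)) -> l w = phi f.
  have [a [b [aa ab e]]] := hull_valP phi.
  have [u hu] := exists_approximable_image aa.
  have [v hv] := exists_approximable_image ab.
  exists (u - v) => l f fl; rewrite dual_sub (hu _ _ fl) (hv _ _ fl).
  by rewrite e dualBE.
have lS : linear S.
  move=> r phi psi; apply: normed_dual_sep => l.
  have [f fl] := exists_adjoint l.
  by rewrite dual_add dual_scale !(hS _ _ _ fl) hullDE hullZE.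
pose S' : {linear hull E -> X} :=
  HB.pack S (GRing.isLinear.Build R (hull E) X _ S lS).
exists S'; split; last first.
  move=> x; apply: normed_dual_sep => l; have [f fl] := exists_adjoint l.
  by rewrite /= (hS _ _ _ fl) hull_embedE.
move=> phi; have FF := fmap_filter S (nbhs_filter phi).
apply/(weak_cvgP (S phi) FF) => l.
have [f fl] := exists_adjoint l; have [g [h [g0 h0 fgh]]] := dual_jordan f.
apply/cvgrPdist_lt => e e0.
apply: (@filterS _ _ (nbhs_filter phi)) (hull_nbhs_lt phi (dual_ge0D g0 h0) e0).
move=> psi /=; rewrite !(hS _ _ _ fl) distrC; apply: le_lt_trans.
by rewrite -hullBE fgh; exact: hull_norm_le_jordan.
Qed.

End extension.

Theorem theorem5p1 (R : realType) (E : lcsRieszType R)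
    (X : completeNormedModType R) (T : {linear E -> X})
    (hE : dedekind_complete E) (hL : lebesgue_property E)
    (hT : continuous T) :
  generalized_b_weakly_compact T <->
  exists (H : lcsRieszType R) (Q : {linear E -> H}) (S : {linear H -> X}),
    [/\ KR_space H, continuous Q, lattice_homomorphism Q,
        continuous (S : H -> weak_space X) & T =1 S \o Q].
Proof.
split=> [gT|[H [Q [S [hK cQ lQ cS TSQ]]]]].
  have [S [cS TS]] := exists_hull_extension hT gT.
  exists (hull E), (@hull_embed R E), S; split=> //.
  - exact/hull_KR_space/dedekind_lebesgue_monotone_complete.
  - exact: hull_embed_continuous.
  - exact: hull_embed_lattice_homomorphism.
exact: (KR_factor_generalized_b_weakly_compact hK cQ lQ cS TSQ).
Qed.
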